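(* There exists an absolute constant $c$ with the following property. For every pair of positive integers $a$ and $b$, and every directed graph $G$ of directed treewidth at least $c\cdot a^6 \cdot b^8 \cdot \log^2(ab)$, there are directed graphs $G_1,G_2,\ldots,G_a$ such that: (1) each $G_i$ is a subgraph of $G$, (2) each vertex of $G$ belongs to at most four of the graphs $G_i$, and (3) each graph $G_i$ has directed treewidth at least $b$.
   Context: Directed treewidth is the standard notion of Johnson, Robertson, Seymour and Thomas.
   Formalization: The factor log(ab) is read as max(1, ln(ab)); for a = b = 1 the literal bound is 0 and the claim fails (a single vertex has directed treewidth 0 and no subgraph of directed treewidth at least 1), while for ab ≥ 2 the change is absorbed into c. *)

(* Defs.v *)
From Stdlib Require Import Reals.
From mathcomp Require Import all_boot.
Set Implicit Arguments. Unset Strict Implicit. Unset Printing Implicit Defensive.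

(* A finite directed graph is given by a vertex set V : {set T} (T a finType)
   and an edge relation E : rel T; its edges are the pairs (u,v) with
   u, v \in V and E u v. *)

Section DTW.
Variable T : finType.

Definition reach_avoid (V : {set T}) (E : rel T) (Z : {set T}) (u v : T) : bool :=
  connect (fun x y => [&& x \in V :\: Z, y \in V :\: Z & E x y]) u v.

(* S is Z-normal (JRST): S \subset V(G) - Z and there is no directed walk in
   G - Z with first and last vertex in S using a vertex of G - (Z \cup S). *)
Definition Z_normal (V : {set T}) (E : rel T) (Z S : {set T}) : bool :=
  [&& S \subset V :\: Z &
      [forall u in S, forall v in S, forall x in V :\: (Z :|: S),
         ~~ (reach_avoid V E Z u x && reach_avoid V E Z x v)]].

(* Arborescence on nodes 'I_n: root, parent map par (par root = root);
   every node reaches the root; edges of R are (par t, t) for t != root,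
   and the edge (par t, t) is identified with its head t. *)

Definition desc n (par : 'I_n -> 'I_n) (t r : 'I_n) : bool :=
  [exists k : 'I_n.+1, iter k par r == t].

Definition below n (par : 'I_n -> 'I_n) (W : 'I_n -> {set T}) (t : 'I_n)
  : {set T} := \bigcup_(r | desc par t r) W r.

(* Arboreal decomposition (R, X, W) of (V, E); X t is the guard X_e of the
   edge e = (par t, t) (X root is irrelevant). *)
Definition arboreal_decomp (V : {set T}) (E : rel T) n (root : 'I_n)
  (par : 'I_n -> 'I_n) (W X : 'I_n -> {set T}) : Prop :=
  par root = root /\
  (forall t, exists k, iter k par t = root) /\
  (forall t, W t != set0) /\
  (forall t s, t != s -> [disjoint W t & W s]) /\
  \bigcup_(t : 'I_n) W t = V /\
  (forall t, X t \subset V) /\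
  (forall t, t != root -> Z_normal V E (X t) (below par W t)).

Definition bag n (root : 'I_n) (par : 'I_n -> 'I_n) (W X : 'I_n -> {set T})
  (t : 'I_n) : {set T} :=
  W t :|: (if t == root then set0 else X t)
      :|: \bigcup_(c | (c != root) && (par c == t)) X c.

(* The width of a decomposition is max_t |bag t| - 1; the directed
   treewidth is the least width.  "directed treewidth of (V,E) >= k":
   the graph is nonempty (the empty graph has treewidth -1) and every
   arboreal decomposition has width >= k. *)
Definition dtw_ge (V : {set T}) (E : rel T) (k : nat) : Prop :=
  V != set0 /\
  forall n (root : 'I_n) par W X, arboreal_decomp V E root par W X ->
    exists t, k < #|bag root par W X t|.

(* directed treewidth >= x for a real x (treewidth is an integer) *)
Definition dtw_geR (V : {set T}) (E : rel T) (x : R) : Prop :=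
  exists k : nat, Rle x (INR k) /\ dtw_ge V E k.

End DTW.

(* c * a^6 * b^8 * log^2(ab), with log(ab) read as max(1, ln(ab)) *)
Definition dtw_bound (c : R) (a b : nat) : R :=
  Rmult (Rmult (Rmult c (pow (INR a) 6)) (pow (INR b) 8))
        (pow (Rmax (IZR 1) (ln (INR (a * b)))) 2).

(* Main.v *)
Require Import Defs.
From Stdlib Require Import Reals.
From mathcomp Require Import all_boot zify.
Set Implicit Arguments. Unset Strict Implicit. Unset Printing Implicit Defensive.

(** Large directed treewidth yields a haven [beta] of large order k.  Call a set
    free if no set smaller than it separates it from the haven, in either
    direction; by matroid intersection every set meeting all [beta Z] with
    |Z| < s contains a free set of size s, and by Menger any two free sets of
    size s are joined by a perfect linkage.  A path meeting all [beta Z] is cut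
    into pieces P_(g,i), for 2a groups g of 16b pieces each, carrying free sets
    A_(g,i) followed by B_(g,i), and linkages are taken from B_(g,i) to A_(g,j)
    for all g, i, j.

    If the paths of any two linkages rarely intersect, a random choice of one
    path per linkage leaves in half of the groups almost all the chosen paths
    disjoint from all the others.  Such a group has directed treewidth at least
    b, and a vertex lies in at most one piece and one chosen path.

    Otherwise two linkages L, L' intersect densely.  Return linkages M, M' close
    them up into permutations of their paths.  The paths are cut into blocks
    which are almost invariant under these permutations, and a pairs of blocks
    are matched greedily so that each pair is still dense.  The intersection
    graph of such a pair contains a highly connected part, and a small directed
    separation of the union of the paths would separate it, so that this union
    has directed treewidth at least b.  A vertex lies on at most one path of
    each of L, L', M, M'. *)

(** * Reachability in induced subgraphs and lower bounds on directed treewidth *)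

Section Reach.
Variable T : finType.
Implicit Types (E : rel T) (V W Z U : {set T}).

Definition within W E : rel T := fun x y => [&& x \in W, y \in W & E x y].
Definition reach W E : rel T := connect (within W E).

Lemma reach_avoidE V E Z : reach_avoid V E Z = reach (V :\: Z) E.
Proof. by []. Qed.

Lemma reach0 W E x : reach W E x x.
Proof. exact: connect0. Qed.

Lemma reach_trans W E y x z : reach W E x y -> reach W E y z -> reach W E x z.
Proof. exact: connect_trans. Qed.

Lemma reach1 W E x y : x \in W -> y \in W -> E x y -> reach W E x y.
Proof. by move=> xW yW xy; apply: connect1; rewrite /within xW yW. Qed.

(** Only the steps lying on a walk from [x] to [y] have to be [e']-steps; this is how walks are
    later confined to a strong component or a reachable region. *)
Lemma connect_step_sub (e e' : rel T) x y :
  (forall z w, connect e x z -> e z w -> connect e w y -> e' z w) ->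
  connect e x y -> connect e' x y.
Proof.
move=> sub /connectP[p]; elim: p x sub => [|z p IH] x sub /=.
  by move=> _ ->; apply: connect0.
case/andP=> xz pz ly.
have zy : connect e z y by apply/connectP; exists p.
apply: (connect_trans (connect1 (sub x z (connect0 _ _) xz zy))).
by apply: IH => // u w zu; apply: sub; apply: connect_trans zu; apply: connect1.
Qed.

Lemma reach_sub W W' E E' x y :
  W \subset W' -> subrel E E' -> reach W E x y -> reach W' E' x y.
Proof.
move=> /subsetP sW sE; apply: connect_step_sub => z w _ /and3P[zW wW zw] _.
by rewrite /within !sW //= sE.
Qed.

Lemma reach_subset W W' E x y : W \subset W' -> reach W E x y -> reach W' E x y.
Proof. by move=> sW; apply: reach_sub. Qed.

Lemma reach_closed W E U x y :
  (forall z w, within W E z w -> z \in U -> w \in U) ->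
  reach W E x y -> x \in U -> y \in U.
Proof.
move=> cl /connectP[p]; elim: p x => [|z p IH] x /= => [_ -> //|].
by case/andP=> xz pz ly xU; apply: IH pz ly _; apply: cl xz xU.
Qed.

Lemma reach_memr W E x y : reach W E x y -> x \in W -> y \in W.
Proof. by apply: reach_closed => z w /and3P[]. Qed.

Lemma reach_rev W E x y : reach W (fun u v => E v u) x y = reach W E y x.
Proof.
rewrite /reach (@eq_connect _ _ (fun u v => within W E v u)); last first.
  by move=> u v; rewrite /within andbCA.
by rewrite connect_rev.
Qed.

Lemma reach_meml W E x y : reach W E x y -> y \in W -> x \in W.
Proof. by rewrite -reach_rev; apply: reach_memr. Qed.

Lemma Z_normal_mutual V E Z U x y :
  Z_normal V E Z U -> x \in U -> y \in V :\: Z ->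
  reach (V :\: Z) E x y -> reach (V :\: Z) E y x -> y \in U.
Proof.
case/andP=> _ /forall_inP nU xU; rewrite inE => /andP[yZ yV] xy yx.
apply/negPn/negP => yU; move: (nU x xU) => /forall_inP/(_ x xU)/forall_inP/(_ y).
by rewrite !inE yV negb_or yZ yU reach_avoidE xy yx => /(_ isT).
Qed.

Section Arborescence.
Variables (n : nat) (root : 'I_n) (par : 'I_n -> 'I_n).
Hypotheses (parR : par root = root) (toR : forall t, exists k, iter k par t = root).

Lemma descP t r : reflect (exists k, iter k par r = t) (desc par t r).
Proof.
apply: (iffP existsP) => [[k /eqP <-]|[k <-]]; first by exists k.
have c : fconnect par r (iter k par r) by apply: fconnect_iter.
have lt : findex par r (iter k par r) < n.+1.
  apply: leqW; apply: leq_trans (findex_max c) _.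
  by rewrite -[X in _ <= X](card_ord n); apply: max_card.
by exists (Ordinal lt) => /=; rewrite iter_findex.
Qed.

Lemma belowP (W : 'I_n -> {set T}) t v :
  reflect (exists2 r, desc par t r & v \in W r) (v \in below par W t).
Proof. exact: bigcupP. Qed.

Lemma depth_ex t : exists k, iter k par t == root.
Proof. by case: (toR t) => k <-; exists k. Qed.

Definition depth t := ex_minn (depth_ex t).

Lemma depth_child t : t != root -> depth (par t) < depth t.
Proof.
move=> tR; rewrite /depth; case: ex_minnP => k _ mk; case: ex_minnP => [[|l]] /=.
  by rewrite (negbTE tR).
by rewrite -iterS iterSr => /mk.
Qed.

(** For the least number of steps from [r] up to [t], if positive, the last node before [t] is a
    child of [t]; minimality keeps it from being the root, which [par] fixes. *)
Lemma below_cases (W : 'I_n -> {set T}) t v :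
  v \in below par W t ->
  v \in W t \/ exists c, [/\ c != root, par c = t & v \in below par W c].
Proof.
case/belowP=> r /descP ex vr.
have {}ex : exists k, iter k par r == t by case: ex => k <-; exists k.
case: (ex_minnP ex) => [[|k]] /eqP /= kt mk; first by left; rewrite -kt.
right; exists (iter k par r); split=> //.
  apply/eqP => cR; have := mk k; rewrite cR -kt cR parR eqxx => /(_ isT).
  by rewrite ltnn.
by apply/belowP; exists r => //; apply/descP; exists k.
Qed.

End Arborescence.

Lemma majority_meet (I : finType) (S A B : {set I}) :
  A \subset S -> B \subset S -> #|S| < 2 * #|A| -> #|S| < 2 * #|B| ->
  exists2 i, i \in A & i \in B.
Proof.
move=> AS BS cA cB; suff : A :&: B != set0 by case/set0Pn=> i /setIP[]; exists i.
rewrite -card_gt0; have := cardsUI A B.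
have : #|A :|: B| <= #|S| by rewrite subset_leq_card // subUset AS.
lia.
Qed.

(** Take a deepest node [t] whose subtree holds a majority of [S]. A strongly connected majority
    survives the deletion of the bag of [t]. It shares an element with the former one and avoids
    [W t], so normality of the guards puts it below [t], and then below a single child: a
    contradiction. *)
Lemma dtw_ge_majority (I : finType) V E b (S : {set I}) (rho : I -> T) :
  (forall Z, #|Z| <= b -> exists A : {set I},
     [/\ A \subset S, #|S| < 2 * #|A|, {in A, forall i, rho i \in V :\: Z}
       & {in A &, forall i j, reach (V :\: Z) E (rho i) (rho j)}]) ->
  dtw_ge V E b.
Proof.
move=> maj; split.
  have [|A [_ cA AV _]] := maj set0; first by rewrite cards0.
  have /set0Pn[i iA] : A != set0 by rewrite -card_gt0; lia.
  by apply/set0Pn; exists (rho i); have := AV _ iA; rewrite setD0.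
move=> n root par W X [parR [toR [_ [_ [WV [_ nX]]]]]].
apply/existsP; apply: contraT => /existsPn small.
(* The root is good by convention, so that a deepest good node exists. *)
pose good t := (t == root) ||
  [exists A : {set I}, [&& A \subset S, #|S| < 2 * #|A| &
     [forall i in A, rho i \in below par W t]]].
have goodR : good root by rewrite /good eqxx.
case: (@arg_maxnP _ root good (depth toR) goodR) => t tgood tmax.
have [|A [AS cA AV Arch]] := maj (bag root par W X t).
  by rewrite leqNgt small.
have /set0Pn[i0 i0A] : A != set0 by rewrite -card_gt0; lia.
(* A guard inside the deleted bag cannot split [A]: one vertex of [A] below [u] brings all of [A]
   below [u]. *)
have spread u : u != root -> X u \subset bag root par W X t ->
    (exists2 i, i \in A & rho i \in below par W u) ->
    {in A, forall i, rho i \in below par W u}.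
  move=> uR Xu [i iA iu] j jA.
  have sD : V :\: bag root par W X t \subset V :\: X u by apply: setDS.
  apply: (Z_normal_mutual (nX u uR) iu); first by rewrite (subsetP sD) ?AV.
    by apply: reach_subset sD _; apply: Arch.
  by apply: reach_subset sD _; apply: Arch.
have At : rho i0 \in below par W t.
  case/orP: tgood => [/eqP ->|/existsP[B /and3P[BS cB /forall_inP Bt]]].
    have := AV _ i0A; rewrite inE -WV => /andP[_ /bigcupP[r _ vr]].
    by apply/belowP; exists r => //; apply/descP.
  case: (eqVneq t root) => [->|tR].
    have := AV _ i0A; rewrite inE -WV => /andP[_ /bigcupP[r _ vr]].
    by apply/belowP; exists r => //; apply/descP.
  apply: spread i0A => //.
    rewrite /bag (negbTE tR); apply: subset_trans (subsetUl _ _); exact: subsetUr.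
  by have [i iA iB] := majority_meet AS BS cA cB; exists i => //; apply: Bt.
have [W0|[c [cR pc ic]]] := below_cases parR At.
  by have := AV _ i0A; rewrite !inE W0.
have Ac : {in A, forall i, rho i \in below par W c}.
  apply: spread => //; last by exists i0.
  rewrite /bag; apply: subset_trans (subsetUr _ _).
  by apply: (bigcup_sup c); rewrite cR pc eqxx.
have : good c.
  apply/orP; right; apply/existsP; exists A; rewrite AS cA /=.
  by apply/forall_inP.
by move/tmax; have := depth_child toR cR; rewrite pc; lia.
Qed.

(* Among the sets of nodes reachable from a node, a smallest one is strongly
   connected, so one-sided reachability bounds suffice. *)
Lemma dtw_ge_reach (I : finType) V E b (S : {set I}) (rho : I -> T) q :
  (forall Z, #|Z| <= b -> exists G : {set I},
     [/\ G \subset S, #|S| + 2 * q < 2 * #|G|, {in G, forall i, rho i \in V :\: Z}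
       & {in G, forall i,
           #|[set j in G | ~~ reach (V :\: Z) E (rho i) (rho j)]| <= q}]) ->
  dtw_ge V E b.
Proof.
move=> H; apply: (@dtw_ge_majority _ _ _ _ S rho) => Z /H[G [GS cG GV Gq]].
pose R i := [set j in G | reach (V :\: Z) E (rho i) (rho j)].
have /set0Pn[i0 i0G] : G != set0 by rewrite -card_gt0; lia.
case: (@arg_minnP _ i0 (mem G) (fun i => #|R i|) i0G) => i iG imin.
have cR : #|R i| + q >= #|G|.
  have := Gq _ iG; rewrite -[#|G|](cardsID [set j | reach (V :\: Z) E (rho i) (rho j)]).
  have -> : G :&: [set j | reach (V :\: Z) E (rho i) (rho j)] = R i.
    by apply/setP=> j; rewrite !inE.
  suff -> : G :\: [set j | reach (V :\: Z) E (rho i) (rho j)] =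
     [set j in G | ~~ reach (V :\: Z) E (rho i) (rho j)] by lia.
  by apply/setP=> j; rewrite !inE andbC.
have RR j : j \in R i -> R j = R i.
  rewrite inE => /andP[jG ij]; apply/eqP; rewrite eqEcard imin // andbT.
  apply/subsetP => l; rewrite !inE => /andP[-> jl] /=; exact: reach_trans ij jl.
exists (R i); split.
- by apply: subset_trans GS; apply/subsetP=> j; rewrite inE => /andP[].
- lia.
- by move=> j; rewrite inE => /andP[jG _]; apply: GV.
- move=> j l jR; rewrite -(RR j jR) inE => /andP[//].
Qed.

End Reach.

(** * Havens, and arboreal decompositions built from balanced separators *)

Section Havens.
Variable T : finType.
Implicit Types (E : rel T) (U Z : {set T}).

(** A haven of order [K + 1], except that [beta Z] is only required to be strongly connected, not to
    be a whole strong component of the graph minus [Z]. *)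
Definition haven E K (beta : {set T} -> {set T}) : Prop :=
  (forall Z, #|Z| <= K ->
     [/\ beta Z != set0, beta Z \subset ~: Z
       & {in beta Z &, forall x y, reach (beta Z) E x y}]) /\
  (forall Z Z', Z \subset Z' -> #|Z'| <= K -> beta Z' \subset beta Z).

Definition scc E Z v : {set T} :=
  [set w | [&& w \notin Z, reach (~: Z) E v w & reach (~: Z) E w v]].

Lemma scc_refl E Z v : v \notin Z -> v \in scc E Z v.
Proof. by move=> vZ; rewrite inE vZ !reach0. Qed.

Lemma scc_eq E Z v w : w \in scc E Z v -> scc E Z w = scc E Z v.
Proof.
rewrite inE => /and3P[_ vw wv]; apply/setP=> x; rewrite !inE.
by apply: andb_id2l => _; apply/andP/andP => -[a b]; split;
  (exact: reach_trans vw a || exact: reach_trans b wv ||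
   exact: reach_trans wv a || exact: reach_trans b vw).
Qed.

Lemma scc_sub E Z Z' v : Z \subset Z' -> scc E Z' v \subset scc E Z v.
Proof.
move=> sZ; have sC : ~: Z' \subset ~: Z by rewrite setCS.
apply/subsetP=> w; rewrite !inE => /and3P[wZ vw wv].
rewrite (reach_subset sC vw) (reach_subset sC wv) !andbT.
by apply: contra wZ; apply: (subsetP sZ).
Qed.

Lemma reach_scc E Z v x y :
  x \in scc E Z v -> y \in scc E Z v -> reach (scc E Z v) E x y.
Proof.
move=> xv yv; move: (yv); rewrite -(scc_eq xv) inE => /and3P[_ xy yx].
rewrite (scc_eq xv); apply: connect_step_sub xy => z w xz zw wy.
have [zZ wZ Ezw] := and3P zw.
have inx u : u \in ~: Z -> reach (~: Z) E x u -> reach (~: Z) E u y -> u \in scc E Z v.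
  rewrite -(scc_eq xv) !inE => -> -> uy /=; exact: reach_trans uy yx.
have xw : reach (~: Z) E x w by apply: connect_trans xz (connect1 zw).
have zy : reach (~: Z) E z y by apply: connect_trans (connect1 zw) wy.
by rewrite /within !inx.
Qed.

(** Two strong components each holding more than [K] of at most [2 * K + 1] elements share one, so
    the large component is unique; it can only grow when [Z] shrinks. *)
Lemma haven_of_unbalanced E K (S : {set T}) :
  #|S| <= 2 * K + 1 ->
  (forall Z, #|Z| <= K -> exists2 v, v \notin Z & K < #|S :&: scc E Z v|) ->
  haven E K (fun Z => [set v | (v \notin Z) && (K < #|S :&: scc E Z v|)]).
Proof.
move=> cS unb; split=> [Z /unb[v vZ vK]|Z Z' sZ _].
  have bE w : w \notin Z -> K < #|S :&: scc E Z w| -> w \in scc E Z v.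
    move=> wZ wK.
    have [] := @majority_meet _ S (S :&: scc E Z v) (S :&: scc E Z w); try lia.
    - exact: subsetIl.
    - exact: subsetIl.
    move=> i /setIP[_ iv] /setIP[_ iw].
    by rewrite -(scc_eq iv) (scc_eq iw) scc_refl.
  have -> : [set v0 | (v0 \notin Z) && (K < #|S :&: scc E Z v0|)] = scc E Z v.
    apply/setP=> w; rewrite inE; apply/andP/idP => [[]|wv]; first exact: bE.
    by rewrite (scc_eq wv); split=> //; move: wv; rewrite inE => /andP[].
  split; first by apply/set0Pn; exists v; apply: scc_refl.
    by apply/subsetP=> w; rewrite !inE => /andP[].
  by move=> x y; apply: reach_scc.
apply/subsetP=> v; rewrite !inE => /andP[vZ vK].
have -> /= : v \notin Z by apply: contra vZ; apply: (subsetP sZ).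
by apply: leq_trans vK _; apply: subset_leq_card; apply: setIS; apply: scc_sub.
Qed.

(* Arboreal decompositions of U below a guard X0, with nodes indexed by
   vertices and D t the union of the bags below t. *)
Record local_decomp E K U (X0 : {set T}) (root : T) (N : {set T}) (par : T -> T)
    (W X D : T -> {set T}) : Prop := LocalDecomp {
  ld_root : root \in N;
  ld_parR : par root = root;
  ld_X : X root = X0;
  ld_D : D root = U;
  ld_DU : forall t, t \in N -> D t \subset U;
  ld_W : forall t, t \in N -> t \in W t;
  ld_WD : forall t, t \in N -> W t \subset D t;
  ld_child : forall t, t \in N -> t != root ->
    [/\ par t \in N, D t \subset D (par t) & par t \notin D t];
  ld_cover : forall t v, t \in N -> v \in D t ->
    v \in W t \/ exists c, [/\ c \in N, c != root, par c = t & v \in D c];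
  ld_norm : forall t, t \in N -> Z_normal setT E (X t) (D t);
  ld_bag : forall t, t \in N -> exists B : {set T},
    [/\ #|B| <= 3 * K + 1, W t \subset B, X t \subset B
      & forall c, c \in N -> c != root -> par c = t -> X c \subset B];
  ld_disj : forall t s v, t \in N -> s \in N -> v \in W t -> v \in W s -> t = s }.

Lemma scc_normal E Z v : v \notin Z -> Z_normal setT E Z (scc E Z v).
Proof.
move=> vZ; apply/andP; split.
  by apply/subsetP=> w; rewrite !inE => /andP[->].
apply/forall_inP => a av; apply/forall_inP => b bv; apply/forall_inP => x.
rewrite !inE andbT negb_or => /andP[xZ] xv; apply: contra xv => /andP[].
rewrite reach_avoidE setTD => ax xb; rewrite xZ /=.
move: av bv; rewrite !inE => /and3P[_ va _] /and3P[_ _ bv].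
by rewrite (reach_trans va ax) (reach_trans xb bv).
Qed.

(** The new root carries [u] and the part of [U] in [Z]. The rest of [U] splits into strong
    components of the graph minus [Y], each guarded by [Z] and the part of [S] in the surrounding
    component of the graph minus [Z]. As [Z] balances [S], such a guard has at most [2 * K]
    vertices, and the recursion applies; keeping [u] at the root makes the components smaller than
    [U]. *)
Lemma local_decomp_glue E K U (X0 : {set T}) Z u :
  #|X0| <= 2 * K -> #|Z| <= K -> u \in U -> Z_normal setT E X0 U ->
  (forall v, v \notin Z -> #|(u |: X0) :&: scc E Z v| <= K) ->
  (forall U' (X' : {set T}), #|U'| < #|U| -> #|X'| <= 2 * K -> U' != set0 ->
     Z_normal setT E X' U' ->
     exists root N par W X D, local_decomp E K U' X' root N par W X D) ->
  exists root N par W X D, local_decomp E K U X0 root N par W X D.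
Proof.
move=> cX0 cZ uU nU bal IH.
pose S := u |: X0; pose Y := S :|: Z.
pose Wr := U :&: (u |: Z); pose R := U :\: (u |: Z).
pose C v := scc E Y v; pose Xg v := Z :|: (S :&: scc E Z v).
have UX0 v : v \in U -> v \notin X0.
  by move=> vU; case/andP: nU => /subsetP/(_ v vU); rewrite !inE => /andP[].
have RU v : v \in R -> v \in U by rewrite inE => /andP[].
have Ru v : v \in R -> v != u by rewrite !inE negb_or => /andP[/andP[]].
have RZ v : v \in R -> v \notin Z by rewrite !inE negb_or => /andP[/andP[]].
have RY v : v \in R -> v \notin Y.
  by move=> vR; rewrite !inE !negb_or Ru ?RZ ?UX0 ?RU.
have XgY v : Xg v \subset Y.
  by rewrite subUset subsetUr /=; apply: subset_trans (subsetIl _ _) (subsetUl _ _).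
(* Deleting the rest of [S] changes nothing: the component lies inside [scc E Z v], and [Xg v]
   contains all of [S] there. *)
have CXg v : v \in R -> C v = scc E (Xg v) v.
  move=> vR; apply/eqP; rewrite eqEsubset scc_sub //=.
  apply/subsetP=> w wv.
  have sXY : {subset scc E (Xg v) v <= ~: Y}.
    move=> x xv; have xZ : x \in scc E Z v by apply: subsetP xv; apply: scc_sub; apply: subsetUl.
    have : x \notin Xg v by move: xv; rewrite inE => /andP[].
    rewrite in_setU in_setI xZ andbT => /norP[xnZ xnS].
    by rewrite in_setC in_setU negb_or xnZ xnS.
  have sCY : scc E (Xg v) v \subset ~: Y by apply/subsetP.
  have vXg : v \in scc E (Xg v) v.
    apply: scc_refl; apply: contra (RY _ vR); exact: subsetP.
  rewrite /C inE -in_setC sXY //=.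
  by rewrite !(reach_subset sCY) // reach_scc.
have CR v : v \in R -> C v \subset R.
  move=> vR; apply/subsetP=> w; rewrite inE => /and3P[wY vw wv].
  have sX : ~: Y \subset setT :\: X0.
    by rewrite setTD setCS /Y; apply: subset_trans (subsetUl _ _); apply: subsetUr.
  have wU : w \in U.
    apply: (Z_normal_mutual nU (RU _ vR)); last 2 first.
    - exact: reach_subset sX vw.
    - exact: reach_subset sX wv.
    by apply: (subsetP sX); rewrite inE.
  rewrite !inE wU andbT; apply: contra wY; rewrite !inE => /orP[->//|->].
  by rewrite orbT.
pose data := (T * {set T} * (T -> T) * (T -> {set T}) * (T -> {set T}) * (T -> {set T}))%type.
have /fin_all_exists[f fP] v : exists d : data, v \in R ->
    let: (r, N, p, W, X, D) := d in local_decomp E K (C v) (Xg v) r N p W X D.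
  case vR : (v \in R); last first.
    by exists (u, set0, id, fun=> set0, fun=> set0, fun=> set0).
  have [||||r [N [p [W [X [D d]]]]]] := IH (C v) (Xg v).
  - apply: proper_card; apply/properP; split.
      by apply: subset_trans (CR _ vR) _; apply/subsetP.
    by exists u => //; rewrite !inE eqxx.
  - have := bal v (RZ _ vR); rewrite -/S; have := (leq_card_setU Z (S :&: scc E Z v)).1.
    rewrite /Xg; lia.
  - by apply/set0Pn; exists v; apply: scc_refl; apply: RY.
  - rewrite CXg //; apply: scc_normal; apply: contra (RY _ vR); exact: subsetP.
  by exists (r, N, p, W, X, D).
(* The picked vertex depends only on the set [C v], so all vertices of a component use the same
   recursive decomposition. *)
pose rep v := odflt v [pick w in C v].
have repC v : v \in R -> rep v \in C v.
  move=> vR; rewrite /rep; case: pickP => //= /(_ v).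
  by rewrite scc_refl ?RY.
have repR v : v \in R -> rep v \in R by move=> vR; apply: (subsetP (CR _ vR)); apply: repC.
have Crep v : v \in R -> C (rep v) = C v by move=> vR; apply: scc_eq; apply: repC.
have rep_eq v w : v \in R -> w \in C v -> rep w = rep v.
  move=> vR wv; rewrite /rep /C (scc_eq wv).
  by case: pickP => //= /(_ v); rewrite scc_refl ?RY.
pose fr v := (f (rep v)).1.1.1.1.1.
pose fN v := (f (rep v)).1.1.1.1.2.
pose fp v := (f (rep v)).1.1.1.2.
pose fW v := (f (rep v)).1.1.2.
pose fX v := (f (rep v)).1.2.
pose fD v := (f (rep v)).2.
have ld v : v \in R ->
    local_decomp E K (C v) (Xg v) (fr v) (fN v) (fp v) (fW v) (fX v) (fD v).
  move=> vR; have := fP (rep v) (repR _ vR).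
  have -> : Xg (rep v) = Xg v.
    rewrite /Xg; congr (_ :|: (_ :&: _)); apply: scc_eq.
    by apply: subsetP (repC _ vR); apply: scc_sub; apply: subsetUr.
  rewrite Crep // /fr /fN /fp /fW /fX /fD.
  by case: (f (rep v)) => [[[[[? ?] ?] ?] ?] ?].
have same v w : v \in R -> w \in C v ->
   [/\ fr w = fr v, fN w = fN v, fp w = fp v, fW w = fW v & fX w = fX v /\ fD w = fD v].
  by move=> vR wv; rewrite /fr /fN /fp /fW /fX /fD (rep_eq _ _ vR wv).
have NC v t : v \in R -> t \in fN v -> t \in C v.
  move=> vR tN; apply: (subsetP (ld_DU (ld _ vR) tN)).
  by apply: (subsetP (ld_WD (ld _ vR) tN)); apply: (ld_W (ld _ vR)).
(* A vertex other than [u] is a node when it is one in the decomposition of its own component; this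
   allows the data to be glued pointwise. *)
pose N := u |: [set t in R | t \in fN t].
have NP t : t \in N -> t != u -> t \in R /\ t \in fN t.
  by rewrite !inE => /orP[/eqP ->|/andP[]//]; rewrite eqxx.
have uR : u \notin R by rewrite !inE eqxx.
have NI v t : v \in R -> t \in fN v -> t \in N /\ t \in R.
  move=> vR tN; have tC := NC _ _ vR tN; have tR := subsetP (CR _ vR) _ tC.
  by rewrite !inE; have [_ -> _ _ _] := same _ _ vR tC; rewrite tN; move: tR; rewrite !inE => ->; rewrite orbT.
pose par t := if t \in R then if t == fr t then u else fp t t else u.
pose W t := if t \in R then fW t t else Wr.
pose X t := if t \in R then fX t t else X0.
pose D t := if t \in R then fD t t else U.
(* The new vertex, the inherited guard and the separator; the guards of the children lie in the same
   union. *)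
have WrB : #|u |: (X0 :|: Z)| <= 3 * K + 1.
  have := (leq_card_setU X0 Z).1; rewrite cardsU1; lia.
exists u, N, par, W, X, D; split.
- by rewrite !inE eqxx.
- by rewrite /par (negbTE uR).
- by rewrite /X (negbTE uR).
- by rewrite /D (negbTE uR).
- move=> t tN; rewrite /D; case: ifP => // tR.
  have [_ tfN] := NP t tN (Ru _ tR).
  apply: subset_trans (ld_DU (ld _ tR) tfN) _; apply: subset_trans (CR _ tR) _.
  by apply/subsetP.
- move=> t tN; rewrite /W; case: (eqVneq t u) => [->|tu].
    by rewrite (negbTE uR) !inE uU eqxx.
  by have [tR tf] := NP t tN tu; rewrite tR (ld_W (ld _ tR)).
- move=> t tN; rewrite /W /D; case: ifP => [tR|_]; last exact: subsetIl.
  by have [_ tf] := NP t tN (Ru _ tR); apply: (ld_WD (ld _ tR)).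
- move=> t tN tu; have [tR tf] := NP t tN tu; rewrite /par tR.
  case: (eqVneq t (fr t)) => [tr|tr].
    rewrite !inE eqxx /D tR (negbTE uR); split=> //.
      apply: subset_trans (ld_DU (ld _ tR) tf) _; apply: subset_trans (CR _ tR) _.
      by apply/subsetP.
    apply: contra uR => ut; apply: (subsetP (CR _ tR)).
    exact: (subsetP (ld_DU (ld _ tR) tf)).
  have [pN pD pn] := ld_child (ld _ tR) tf tr.
  have [pN' pR] := NI _ _ tR pN; rewrite pN' /D tR pR.
  by have [_ _ _ _ [_ ->]] := same _ _ tR (NC _ _ tR pN).
- move=> t v tN; rewrite /D /W; case: ifP => [tR vt|tR vU].
    have [_ tf] := NP t tN (Ru _ tR).
    have [vW|[c [cN cr cp vc]]] := ld_cover (ld _ tR) tf vt; first by left.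
    have [cN' cR] := NI _ _ tR cN; right; exists c.
    have [e1 e2 e3 e4 [e5 e6]] := same _ _ tR (NC _ _ tR cN).
    by rewrite cN' Ru // /par cR e1 e3 (negbTE cr) cp e6.
  have tu : t = u by apply/eqP; apply: contraFT tR => /(NP _ tN)[].
  case vR : (v \in R); last first.
    left; move: vR vU; rewrite !inE => vR vU; rewrite vU /= in vR *.
    by move: vR; rewrite andbT => /negbFE.
  have rN := ld_root (ld _ vR); have [rN' rR] := NI _ _ vR rN; right; exists (fr v).
  have [e1 e2 e3 e4 [e5 e6]] := same _ _ vR (NC _ _ vR rN).
  rewrite rN' Ru // /par rR e1 eqxx tu e6; split=> //.
  by rewrite (ld_D (ld _ vR)) scc_refl ?RY.
- move=> t tN; rewrite /X /D; case: ifP => [tR|//].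
  by have [_ tf] := NP t tN (Ru _ tR); apply: (ld_norm (ld _ tR)).
- move=> t tN; rewrite /W /X; case: (eqVneq t u) => [->|tu].
    rewrite (negbTE uR); exists (u |: (X0 :|: Z)); split=> //.
    - by apply: subset_trans (subsetIr _ _) _; apply: setUS; apply: subsetUr.
    - by apply: subset_trans (subsetUr _ _); apply: subsetUl.
    move=> c cN cu; have [cR cf] := NP c cN cu; rewrite /par cR.
    case: (eqVneq c (fr c)) => [cr _|cr cp]; last first.
      have [pN _ _] := ld_child (ld _ cR) cf cr.
      by move: uR; rewrite -cp (subsetP (CR _ cR)) // NC.
    have -> : fX c c = Xg c by rewrite -(ld_X (ld _ cR)) -cr.
    apply: subset_trans (XgY c) _; rewrite /Y /S -setUA; exact: subxx.
  have [tR tf] := NP t tN tu; rewrite tR.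
  have [B [cB WB XB ch]] := ld_bag (ld _ tR) tf; exists B; split=> // c cN cu.
  have [cR cf] := NP c cN cu; rewrite /par cR.
  case: (eqVneq c (fr c)) => [cr ut|cr cp]; first by rewrite -ut eqxx in tu.
  have [pN _ _] := ld_child (ld _ cR) cf cr; rewrite cp in pN.
  have [e1 e2 e3 e4 [e5 e6]] := same _ _ cR (NC _ _ cR pN).
  by rewrite -e5; apply: ch; rewrite ?e2 ?e1 ?e3.
- move=> t s v tN sN.
  have WR r : r \in R -> r \in N -> v \in fW r r -> v \in C r.
    move=> rR rN vr; have [_ rf] := NP r rN (Ru _ rR).
    apply: (subsetP (ld_DU (ld _ rR) rf)).
    exact: (subsetP (ld_WD (ld _ rR) rf)).
  have WrR : v \in Wr -> v \notin R by rewrite !inE => /andP[_ ->].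
  have NR r : r \in N -> r \notin R -> r = u.
    by move=> rN rR; apply/eqP; apply: contraNT rR => /(NP _ rN)[].
  rewrite /W; case: (boolP (t \in R)) => tR; case: (boolP (s \in R)) => sR vt vs.
  + have vtC := WR t tR tN vt; have vsC := WR s sR sN vs.
    have [_ tf] := NP t tN (Ru _ tR); have [_ sf] := NP s sN (Ru _ sR).
    have sC : s \in C t by rewrite /C -(scc_eq vtC) (scc_eq vsC) scc_refl ?RY.
    have [_ e2 _ e4 _] := same _ _ tR sC.
    by apply: (ld_disj (ld _ tR) tf _ vt); rewrite -?e2 -?e4.
  + by have := WrR vs; rewrite (subsetP (CR _ tR)) // WR.
  + by have := WrR vt; rewrite (subsetP (CR _ sR)) // WR.
  + by rewrite (NR t) // (NR s).
Qed.

End Havens.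

(** * Existence of havens in graphs of large directed treewidth *)

Section HavenExistence.
Variable T : finType.
Implicit Types (E : rel T) (U Z : {set T}).

Lemma local_decomp_exists E K :
  (forall S : {set T}, #|S| <= 2 * K + 1 -> exists2 Z : {set T}, #|Z| <= K &
     forall v, v \notin Z -> #|S :&: scc E Z v| <= K) ->
  forall U (X0 : {set T}), #|X0| <= 2 * K -> U != set0 -> Z_normal setT E X0 U ->
  exists root N par W X D, local_decomp E K U X0 root N par W X D.
Proof.
move=> bal U; have [n] := ubnP #|U|; elim: n U => // n IH U cU X0 cX /set0Pn[u uU] nU.
have [|Z cZ Zb] := bal (u |: X0); first by rewrite cardsU1; lia.
apply: (local_decomp_glue cX cZ uU nU Zb) => U' X' cU' cX' U'0 nU'.
by apply: IH => //; lia.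
Qed.

(** [D] strictly grows from a node to its parent. This gives the path to the root and also the
    induction showing that [D t] is the union of the sets [W] below [t]. *)
Lemma arboreal_of_local E K X0 root N par W X D :
  local_decomp E K [set: T] X0 root N par W X D ->
  exists n (root' : 'I_n) par' (W' X' : 'I_n -> {set T}),
    arboreal_decomp [set: T] E root' par' W' X' /\
    forall t, #|bag root' par' W' X' t| <= 3 * K + 1.
Proof.
move=> ld; have rN := ld_root ld.
pose idx t := enum_rank_in rN t; pose vl (i : 'I_#|N|) := enum_val i.
have vN i : vl i \in N by apply: enum_valP.
have vlK t : t \in N -> vl (idx t) = t by apply: enum_rankK_in.
have vlI : injective vl by apply: enum_val_inj.
pose par' i := idx (par (vl i)).
have pN t : t \in N -> par t \in N.
  by case: (eqVneq t root) => [-> _|tr tN]; [rewrite (ld_parR ld)|case: (ld_child ld tN tr)].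
have vp i : vl (par' i) = par (vl i) by rewrite vlK ?pN.
have vroot : vl (idx root) = root by rewrite vlK.
have Dpar t : t \in N -> D t \subset D (par t).
  case: (eqVneq t root) => [-> _|tr tN]; first by rewrite (ld_parR ld).
  by case: (ld_child ld tN tr).
have cDpar t : t \in N -> t != root -> #|D t| < #|D (par t)|.
  move=> tN tr; have [ptN sD nD] := ld_child ld tN tr.
  apply: proper_card; apply/properP; split=> //; exists (par t) => //.
  by apply: (subsetP (ld_WD ld ptN)); apply: (ld_W ld).
have parR : par' (idx root) = idx root by rewrite /par' vroot (ld_parR ld).
have toR i : exists k, iter k par' i = idx root.
  have [n] := ubnP (#|T| - #|D (vl i)|); elim: n i => // n IH i lt.
  case: (eqVneq (vl i) root) => [e|ir]; first by exists 0; apply: vlI; rewrite vroot.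
  have [|k ki] := IH (par' i); last by exists k.+1; rewrite iterSr.
  have := cDpar _ (vN i) ir; have := max_card (D (par (vl i))); rewrite vp; move: lt; lia.
have bD i : below par' (W \o vl) i = D (vl i).
  apply/setP=> v; apply/belowP/idP => [[r /descP[k <-] /= vr]|].
    have : v \in D (vl r) by apply: (subsetP (ld_WD ld (vN r))).
    elim: k => //= k IH /IH; rewrite vp; apply: (subsetP (Dpar _ _)); exact: vN.
  have [n] := ubnP #|D (vl i)|; elim: n i => // n IH i lt vi.
  have [vW|[c [cN cr pc vc]]] := ld_cover ld (vN i) vi.
    by exists i => //; apply/descP; exists 0.
  have [||r /descP[k kr] vr] := IH (idx c).
  - have := cDpar _ cN cr; rewrite pc vlK //; lia.
  - by rewrite vlK.
  exists r => //; apply/descP; exists k.+1; rewrite iterS kr.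
  by apply: vlI; rewrite vp vlK.
exists #|N|, (idx root), par', (W \o vl), (X \o vl); split; last first.
  move=> i; have [B [cB WB XB ch]] := ld_bag ld (vN i).
  apply: leq_trans cB; apply: subset_leq_card; rewrite /bag !subUset.
  apply/andP; split; first by rewrite WB; case: ifP => //; rewrite sub0set.
  apply/bigcupsP => c /andP[cr /eqP pc]; apply: ch => //.
    by apply: contra cr => /eqP e; apply/eqP/vlI; rewrite vroot.
  by rewrite -vp pc.
split=> //; split=> //; split; first by move=> t; apply/set0Pn; exists (vl t); apply: (ld_W ld).
split; first move=> t s ts.
  rewrite -setI_eq0; apply/eqP/setP=> v; rewrite !inE; apply/negP=> /andP[vt vs].
  by case/eqP: ts; apply: vlI; apply: (ld_disj ld _ _ vt vs).
split; last by split=> // t _; rewrite bD; apply: (ld_norm ld).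
apply/setP=> v; rewrite inE; apply/bigcupP.
have : v \in below par' (W \o vl) (idx root) by rewrite bD vroot (ld_D ld).
by case/belowP=> r _ vr; exists r.
Qed.

(** If every set of at most [2 * K + 1] vertices had a balanced separator of size at most [K], the
    recursion would give a decomposition with all bags of size at most [3 * K + 1]. So some set has
    none, and its majority components form a haven. *)
Lemma dtw_ge_haven E K :
  dtw_ge [set: T] E (3 * K + 1) -> exists beta, haven E K beta.
Proof.
case=> T0 big.
suff [S [cS unb]] : exists S : {set T}, #|S| <= 2 * K + 1 /\
    forall Z, #|Z| <= K -> exists2 v, v \notin Z & K < #|S :&: scc E Z v|.
  by exists (fun Z => [set v | (v \notin Z) && (K < #|S :&: scc E Z v|)]);
     apply: haven_of_unbalanced.
pose unb (S : {set T}) := [forall Z : {set T}, (#|Z| <= K) ==>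
  [exists v, (v \notin Z) && (K < #|S :&: scc E Z v|)]].
case: (boolP [exists S : {set T}, (#|S| <= 2 * K + 1) && unb S]).
  case/existsP=> S /andP[cS /forallP uS]; exists S; split=> // Z cZ.
  by have := uS Z; rewrite cZ => /existsP[v /andP[]]; exists v.
move/existsPn => nS.
have [||||r [N [p [W [X [D ld]]]]]] := @local_decomp_exists E K _ [set: T] set0.
- move=> S cS; have := nS S; rewrite cS /= => /forallPn[Z].
  rewrite negb_imply => /andP[cZ /existsPn nv]; exists Z => // v vZ.
  by have := nv v; rewrite vZ /= -leqNgt.
- by rewrite cards0.
- exact: T0.
- apply/andP; split; first by apply/subsetP=> x; rewrite !inE.
  apply/forall_inP=> a _; apply/forall_inP=> b _; apply/forall_inP=> x.
  by rewrite !inE orbT.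
have [n [root' [par' [W' [X' [ad small]]]]]] := arboreal_of_local ld.
by have [t] := big _ _ _ _ _ ad; rewrite ltnNge small.
Qed.

End HavenExistence.

(** * Menger's theorem for disjoint directed paths *)

Section Menger.
Variable T : finType.
Implicit Types (E : rel T) (A B S Z : {set T}).

Definition sep E A B Z : Prop :=
  forall a b, a \in A -> b \in B -> a \notin Z -> b \notin Z -> ~~ reach (~: Z) E a b.

Definition rev_rel E : rel T := fun u v => E v u.

Definition del_edge E x y : rel T := fun u v => E u v && ((u, v) != (x, y)).

Lemma sep_rev E A B Z : sep E A B Z -> sep (rev_rel E) B A Z.
Proof. by move=> s b a bB aA bZ aZ; rewrite reach_rev s. Qed.

Lemma eq_reach (W : {set T}) E E' : E =2 E' -> reach W E =2 reach W E'.
Proof. by move=> e; apply: eq_connect => u v; rewrite /within e. Qed.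

Lemma eq_sep E E' A B Z : E =2 E' -> sep E A B Z -> sep E' A B Z.
Proof. by move=> e s a b aA bB aZ bZ; rewrite -(eq_reach _ e) s. Qed.

(** The region reached from [A] outside [Z] without the edge [xy] avoids [x], so adding that edge
    does not enlarge it; it also avoids [S], so it contains no vertex of [B]. *)
Lemma sep_push E x y A B S Z :
  sep (del_edge E x y) A B S -> sep (del_edge E x y) A (x |: S) Z -> sep E A B Z.
Proof.
move=> sS sZ a b aA bB aZ bZ; apply/negP => ab.
pose U := [set v | (v \notin Z) && reach (~: Z) (del_edge E x y) a v].
have US v : v \in U -> v \notin x |: S.
  rewrite inE => /andP[vZ av]; apply/negP => vS.
  by have := sZ a v aA vS aZ vZ; rewrite av.
have bU : b \in U.
  apply: (reach_closed _ ab); last by rewrite inE aZ reach0.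
  move=> z w /and3P[zZ wZ zw] zU; have := US z zU; rewrite !inE negb_or => /andP[zx _].
  move: zU wZ; rewrite !inE => /andP[_ az] wZ; rewrite wZ /=.
  apply: reach_trans az _; apply: reach1 => //; first by rewrite inE.
  by rewrite /del_edge zw; apply: contra zx => /eqP[->].
have SU v : v \in U -> v \notin S by move/US; rewrite !inE negb_or => /andP[].
have aU : a \in U by rewrite inE aZ reach0.
have := sS a b aA bB (SU a aU) (SU b bU); apply/negP/negPn.
move: bU; rewrite inE => /andP[_]; apply: connect_step_sub => z w az zw _.
have aw : reach (~: Z) (del_edge E x y) a w := connect_trans az (connect1 zw).
case/and3P: zw; rewrite !in_setC => zZ wZ zw.
have zU : z \in U by rewrite inE zZ.
have wU : w \in U by rewrite inE wZ.
by rewrite /within !in_setC !SU.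
Qed.

Lemma sep_edge_head E x y A B S :
  sep (del_edge E x y) A B S -> sep E A B (x |: S).
Proof.
by move=> sS; apply: sep_push sS _ => a b _ bS _; rewrite bS.
Qed.

Lemma rev_del_edge E x y : rev_rel (del_edge E x y) =2 del_edge (rev_rel E) y x.
Proof. by move=> u v; rewrite /rev_rel /del_edge !xpair_eqE [(v == x) && _]andbC. Qed.

Lemma sep_push_rev E x y A B S Z :
  sep (del_edge E x y) A B S -> sep (del_edge E x y) (y |: S) B Z -> sep E A B Z.
Proof.
move=> /sep_rev/(eq_sep (rev_del_edge E x y)) sS.
move=> /sep_rev/(eq_sep (rev_del_edge E x y)) sZ.
exact: (sep_rev (sep_push sS sZ)).
Qed.

Lemma sep_edge_tail E x y A B S :
  sep (del_edge E x y) A B S -> sep E A B (y |: S).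
Proof.
by move=> sS; apply: sep_push_rev sS _ => a b aS _; rewrite aS.
Qed.

Lemma path_reach (W : {set T}) E x p : path E x p -> {subset x :: p <= W} -> reach W E x (last x p).
Proof.
elim: p x => [|y p IH] x /=; first by rewrite reach0.
case/andP=> xy py sW; apply: (@reach_trans _ _ _ y).
  by apply: reach1; rewrite ?sW ?inE ?eqxx ?orbT.
by apply: IH => // z zp; apply: sW; rewrite inE zp orbT.
Qed.

(** [F] is the set of first vertices; [p a] lists the vertices after [a] on the path starting at
    [a]. *)
Definition linkage_from E A B (F : {set T}) (p : T -> seq T) : Prop :=
  [/\ F \subset A,
      forall a, a \in F -> [/\ path E a (p a), uniq (a :: p a) & last a (p a) \in B]
    & forall a a' v, a \in F -> a' \in F -> v \in a :: p a -> v \in a' :: p a' -> a = a'].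

(** A path into [x |: S] and a path out of [y |: S] can only meet in [S], at the end of the first
    and the start of the second; otherwise they would give a walk from [A] to [B] around [S]. Hence
    they can be joined at the vertices of [S] and along the edge [xy]. *)
Lemma linkage_compose E A B S x y k (F F' : {set T}) p p' :
  E x y -> x \notin S -> y \notin S -> #|S|.+1 = k ->
  sep (del_edge E x y) A B S ->
  #|F| = k -> linkage_from (del_edge E x y) A (x |: S) F p ->
  #|F'| = k -> linkage_from (del_edge E x y) (y |: S) B F' p' ->
  exists p'', linkage_from E A B F p''.
Proof.
set E' := del_edge E x y => xy xS yS cS sS cF [FA Fp Fd] cF' [F'A F'p F'd].
have cxS : #|x |: S| = k by rewrite cardsU1 xS.
have cyS : #|y |: S| = k by rewrite cardsU1 yS.
have F'E : F' = y |: S by apply/eqP; rewrite eqEcard F'A cF' cyS leqnn.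
have lastE : [set last a (p a) | a in F] = x |: S.
  apply/eqP; rewrite eqEcard; apply/andP; split.
    by apply/subsetP=> _ /imsetP[a aF ->]; case: (Fp a aF).
  rewrite cxS card_in_imset ?cF // => a a' aF a'F e.
  by apply: (Fd a a' (last a (p a))) => //; [|rewrite e]; apply: mem_last.
have pS a v : a \in F -> v \in a :: p a -> v \in S -> v = last a (p a).
  move=> aF va vS; have : v \in x |: S by rewrite inE vS orbT.
  rewrite -lastE => /imsetP[a' a'F e].
  by rewrite (Fd a a' v aF a'F va) // e mem_last.
have p'S f v : f \in F' -> v \in f :: p' f -> v \in S -> v = f.
  move=> fF' vf vS; apply: (F'd v f v) => //; first by rewrite F'E inE vS orbT.
  by rewrite mem_head.
have common a f v : a \in F -> f \in F' -> v \in a :: p a -> v \in f :: p' f ->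
    [/\ v \in S, v = last a (p a) & v = f].
  move=> aF fF' va vf; suff vS : v \in S by split; [|exact: pS|exact: p'S].
  apply: contraT => vS; have [pa ua _] := Fp a aF; have [pf uf lf] := F'p f fF'.
  have av : reach (~: S) E' a v.
    have := pS a; have := va.
    case/splitPl: va pa ua => p1 p2 l1; rewrite cat_path -cat_cons cat_uniq.
    move=> /andP[pp1 _] /and3P[_ hasp _] _ pSa; rewrite -l1; apply: path_reach => // w w1.
    rewrite inE; apply/negP => wS; have := pSa w aF.
    rewrite mem_cat w1 => /(_ isT wS).
    rewrite last_cat; case: p2 hasp {pSa} => [|z p2] hasp /= e.
      by rewrite -l1 -e wS in vS.
    by case/hasP: hasp; exists w => //; rewrite e mem_last.
  have vb : reach (~: S) E' v (last f (p' f)).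
    have := p'S f.
    case/splitPl: vf pf uf => p1 p2 l1; rewrite cat_path last_cat -cat_cons cat_uniq l1.
    move=> /andP[_ pp2] /and3P[_ hasp _] p'Sf; apply: path_reach => // w w2.
    rewrite inE; apply/negP => wS; have := p'Sf w fF'.
    have wf : w \in (f :: p1) ++ p2.
      move: w2; rewrite inE mem_cat => /orP[/eqP ->|->]; last by rewrite orbT.
      by rewrite -l1 mem_last.
    move=> /(_ wf wS) e; move: w2; rewrite inE => /orP[/eqP wv|w2].
      by rewrite -wv wS in vS.
    by case/hasP: hasp; exists w => //; rewrite e mem_head.
  have [aS bS] : a \notin S /\ last f (p' f) \notin S.
    split.
    - by have := reach_meml av; rewrite !inE; apply.
    - by have := reach_memr vb; rewrite !inE; apply.
  have := sS a (last f (p' f)) (subsetP FA _ aF) lf aS bS.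
  by rewrite (reach_trans av vb).
have sE : subrel E' E by move=> u v /andP[].
(* The continuation starts at [nx a]; [q a] omits this vertex when it already ends [p a], and
   contains it when the edge [xy] leads there. *)
pose nx a := if last a (p a) \in S then last a (p a) else y.
pose q a := if last a (p a) \in S then p' (last a (p a)) else y :: p' y.
have nxF a : nx a \in F' by rewrite F'E /nx; case: ifP => h; rewrite !inE ?h ?eqxx ?orbT.
have qsub a v : v \in q a -> v \in nx a :: p' (nx a).
  by rewrite /q /nx; case: ifP => // _ h; rewrite inE h orbT.
have qnp a v : a \in F -> v \in q a -> forall a', a' \in F -> v \notin a' :: p a'.
  move=> aF vq a' a'F; apply/negP => va'.
  have [vS e1 e2] := common a' (nx a) v a'F (nxF a) va' (qsub _ _ vq).
  move: vq e2; rewrite /q /nx; case: ifP => lS vq e2.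
    have [_ + _] := F'p _ (nxF a); rewrite /nx lS /=.
    by rewrite -e2 in vq * => /andP[]; rewrite vq.
  by rewrite -e2 vS in yS.
have nx_inj a a' : a \in F -> a' \in F -> nx a = nx a' -> a = a'.
  have lx a0 : a0 \in F -> last a0 (p a0) \notin S -> last a0 (p a0) = x.
    move=> aF; have [_ _] := Fp a0 aF; rewrite !inE => /orP[/eqP //|->//].
  have li a0 a1 : a0 \in F -> a1 \in F -> last a0 (p a0) = last a1 (p a1) -> a0 = a1.
    move=> a0F a1F e; apply: (Fd a0 a1 (last a0 (p a0))) => //; first exact: mem_last.
    by rewrite e mem_last.
  move=> aF a'F; rewrite /nx; case: ifP => h1; case: ifP => h2 e; apply: li => //.
  - by move: h1; rewrite e (negbTE yS).
  - by move: h2; rewrite -e (negbTE yS).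
  - by rewrite (lx _ aF (negbT h1)) (lx _ a'F (negbT h2)).
exists (fun a => p a ++ q a); split=> //.
- move=> a aF; have [pa ua la] := Fp a aF; have [pf uf lf] := F'p _ (nxF a).
  rewrite cat_path (sub_path sE pa) last_cat -cat_cons cat_uniq ua /=.
  have -> /= : ~~ has (mem (a :: p a)) (q a).
    apply/negP=> /hasP[v vq /= va]; by have := qnp _ _ aF vq a aF; rewrite va.
  move: pf uf lf la; rewrite /nx /q; case: ifP => lS pf uf lf.
    by rewrite (sub_path sE pf) lf; move: uf; rewrite cons_uniq => /andP[_ ->].
  rewrite !inE lS orbF => /eqP -> /=; rewrite xy (sub_path sE pf) lf; split=> //.
- move=> a a' v aF a'F; rewrite -!cat_cons !mem_cat.
  case/orP=> va /orP[va'|va'].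
  + exact: Fd va va'.
  + by have := qnp _ _ a'F va' a aF; rewrite va.
  + by have := qnp _ _ aF va a' a'F; rewrite va'.
  + apply: nx_inj => //; apply: (F'd _ _ v); rewrite ?nxF ?qsub //.
Qed.

(* Goering's proof, by induction on the number of edges. *)
Lemma menger E A B k :
  (forall Z, sep E A B Z -> k <= #|Z|) ->
  exists (F : {set T}) p, #|F| = k /\ linkage_from E A B F p.
Proof.
have [n] := ubnP #|[set e : T * T | E e.1 e.2]|.
elim: n E A B => // n IH E A B cE kmin.
case: (pickP [pred e : T * T | E e.1 e.2]) => [[x y] /= xy|E0].
  pose E' := del_edge E x y.
  have cE' : #|[set e : T * T | E' e.1 e.2]| < n.
    rewrite -ltnS; apply: leq_trans cE; rewrite ltnS; apply: proper_card.
    apply/properP; split; first by apply/subsetP=> e; rewrite !inE => /andP[].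
    by exists (x, y); rewrite !inE //= /E' /del_edge eqxx andbF.
  have sE : subrel E' E by move=> u v /andP[].
  (* If fewer than [k] vertices [S] separate once [xy] is deleted, adding [x] or [y] to [S]
     separates the whole graph. So [S] has exactly [k - 1] vertices, and induction gives linkages of
     size [k] on both sides of it. *)
  case: (boolP [exists S : {set T}, (#|S| < k) &&
      [forall a in A, forall b in B,
         (a \notin S) ==> (b \notin S) ==> ~~ reach (~: S) E' a b]]).
    case/existsP=> S /andP[cS /forall_inP sS'].
    have sS : sep E' A B S.
      move=> a b aA bB aS bS; have /forall_inP/(_ b bB) := sS' a aA.
      by rewrite aS bS.
    have := kmin _ (sep_edge_head sS); have := kmin _ (sep_edge_tail sS).
    rewrite !cardsU1 => cy cx.
    have xS : x \notin S by move: cx cS; case: (x \in S) => //=; lia.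
    have yS : y \notin S by move: cy cS; case: (y \in S) => //=; lia.
    rewrite xS in cx.
    have [Z sZ|F [p [cF lF]]] := IH E' A (x |: S) cE'.
      exact: kmin (sep_push sS sZ).
    have [Z sZ|F' [p' [cF' lF']]] := IH E' (y |: S) B cE'.
      exact: kmin (sep_push_rev sS sZ).
    have [|p'' l] := linkage_compose xy xS yS _ sS cF lF cF' lF'; first lia.
    by exists F, p''.
  move/existsPn => nS; have [Z sZ|F [p [cF [FA Fp Fd]]]] := IH E' A B cE'.
    rewrite leqNgt; apply/negP => cZ; have := nS Z; rewrite cZ /= => /negP[].
    apply/forall_inP => a aA; apply/forall_inP => b bB.
    by apply/implyP => aZ; apply/implyP => bZ; apply: sZ.
  exists F, p; split=> //; split=> // a /Fp[pa ua la]; split=> //.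
  exact: sub_path pa.
(* Without edges, [A :&: B] separates, and its vertices are paths of length zero. *)
have : k <= #|A :&: B|.
  apply: kmin => a b aA bB aAB bAB; apply/negP => /connectP[[|z p] /=].
    by move=> _ e; move: aAB; rewrite inE aA -e bB.
  by case/andP=> /and3P[_ _ az]; have := E0 (a, z); rewrite /= az.
case/card_geqP => F [uF sF FAB].
exists [set v in F], (fun=> [::]); split; first by rewrite cardsE (card_uniqP uF).
split.
- by apply/subsetP=> v; rewrite inE => /FAB; rewrite inE => /andP[].
- by move=> a; rewrite inE => /FAB; rewrite inE => /andP[].
- by move=> a a' v _ _; rewrite !inE => /eqP -> /eqP.
Qed.

(* Only the vertex set of a path is kept, since the packed graphs will be
   induced subgraphs. *)
Definition thread E (Q : {set T}) x y : Prop :=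
  [/\ x \in Q, y \in Q & forall v, v \in Q -> reach Q E x v /\ reach Q E v y].

Lemma path_thread E x p : path E x p -> thread E [set v in x :: p] x (last x p).
Proof.
move=> px; split; rewrite ?inE ?eqxx ?mem_last //.
  by have := mem_last x p; rewrite inE.
move=> v; rewrite inE => vp.
case/splitPl: vp px => p1 p2 l1; rewrite cat_path => /andP[pp1 pp2].
split; first rewrite -l1.
  by apply: path_reach => // w w1; rewrite inE -cat_cons mem_cat w1.
rewrite last_cat l1 in pp2 *; apply: path_reach => // w; rewrite !inE mem_cat.
case/orP=> [/eqP ->|->]; last by rewrite !orbT.
by have := mem_last x p1; rewrite l1 inE => /orP[->|->]; rewrite ?orbT.
Qed.

(** The starts [al] are prescribed, so that a return linkage can begin exactly where the first
    linkage ends. *)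
Lemma menger_threads E (A B : {set T}) s :
  #|A| = s -> #|B| = s -> (forall Z, #|Z| < s -> ~ sep E A B Z) ->
  forall al : 'I_s -> T, injective al -> (forall i, al i \in A) ->
  exists (Q : 'I_s -> {set T}) (om : 'I_s -> T),
    [/\ forall i, thread E (Q i) (al i) (om i),
        forall i j v, v \in Q i -> v \in Q j -> i = j,
        injective om & forall i, om i \in B].
Proof.
move=> cA cB ns al alI alA.
have [|F [p [cF [FA Fp Fd]]]] := @menger E A B s.
  by move=> Z sZ; rewrite leqNgt; apply/negP => /ns.
have FE : F = A by apply/eqP; rewrite eqEcard FA cA cF leqnn.
rewrite {}FE in Fp Fd.
exists (fun i => [set v in al i :: p (al i)]), (fun i => last (al i) (p (al i))).
have D i j v : v \in al i :: p (al i) -> v \in al j :: p (al j) -> i = j.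
  by move=> vi vj; apply: alI; apply: Fd vi vj.
split.
- by move=> i; have [pa _ _] := Fp _ (alA i); apply: path_thread.
- by move=> i j v; rewrite !inE; apply: D.
- by move=> i j /= e; apply: (D i j _ (mem_last _ _)); rewrite e; apply: mem_last.
- by move=> i; case: (Fp _ (alA i)).
Qed.

End Menger.

(** * Matroid intersection, by deletion and contraction *)

Section MatroidIntersection.
Variable T : finType.
Implicit Types (A B G X : {set T}).

Record rankfun (r : {set T} -> nat) : Prop := RankFun {
  rank0 : r set0 = 0;
  rank_mono : forall A B, A \subset B -> r A <= r B;
  rank_unit : forall e A, r (e |: A) <= (r A).+1;
  rank_submod : forall A B, r (A :|: B) + r (A :&: B) <= r A + r B }.

Lemma rankfun_contract r e :
  rankfun r -> r [set e] = 1 -> rankfun (fun A => r (e |: A) - 1).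
Proof.
move=> rr e1; have ge1 A : 0 < r (e |: A) by rewrite -e1 rank_mono ?subsetUl.
split.
- by rewrite setU0 e1.
- by move=> A B AB; rewrite leq_sub2r // rank_mono // setUS.
- by move=> f A; have := rank_unit rr f (e |: A); have := ge1 A; rewrite setUCA; lia.
- move=> A B; have := rank_submod rr (e |: A) (e |: B).
  rewrite -setUIr -setUUr.
  have := ge1 A; have := ge1 B; have := ge1 (A :&: B); have := ge1 (A :|: B); lia.
Qed.

Lemma rank_loop r e A : rankfun r -> r [set e] = 0 -> r (e |: A) = r A.
Proof.
move=> rr e0; have := rank_submod rr [set e] A; rewrite e0.
have := rank_mono rr (subsetUr [set e] A); lia.
Qed.

(** Delete an element [e] if the rank condition survives, otherwise contract it. If both fail, with
    witnesses [A1] and [B], submodularity at [A1] and [e |: B], and at the corresponding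
    complements, contradicts the condition at [A1 :&: B] and [A1 :|: (e |: B)]. *)
Lemma matroid_intersection r1 r2 G k :
  rankfun r1 -> rankfun r2 ->
  (forall A, A \subset G -> k <= r1 A + r2 (G :\: A)) ->
  exists X, [/\ X \subset G, #|X| = k, r1 X = k & r2 X = k].
Proof.
have [n] := ubnP #|G|; elim: n G k r1 r2 => // n IH G k r1 r2 cG R1 R2 H.
case: k H => [|k] H.
  by exists set0; rewrite sub0set cards0 (rank0 R1) (rank0 R2).
case: (set_0Vmem G) => [G0|[e eG]].
  by have := H set0; rewrite sub0set G0 setD0 (rank0 R1) (rank0 R2) => /(_ isT).
have cGe : #|G :\ e| < n by have := cardsD1 e G; rewrite eG; lia.
have GeG : G :\ e \subset G by rewrite subD1set.
have inGe A : A \subset G :\ e -> e |: A \subset G /\ e \notin A.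
  rewrite subsetD1 => /andP[AG eA]; split=> //.
  by rewrite subUset sub1set eG.
have D1 A : G :\ e :\: A = G :\: (e |: A) by rewrite setDDl.
have D2 A : e \notin A -> e |: (G :\ e :\: A) = G :\: A.
  move=> eA; apply/setP=> x; rewrite !inE; case: eqVneq => [->|] //=.
  by rewrite eA eG.
have up X : X \subset G :\ e -> X \subset G by move=> /subset_trans; apply.
case: (boolP [forall A : {set T}, (A \subset G :\ e) ==>
         (k.+1 <= r1 A + r2 (G :\ e :\: A))]) => [/forallP ok|].
  have [A AG|X [XG cX X1 X2]] := IH (G :\ e) k.+1 r1 r2 cGe R1 R2.
    by have := ok A; rewrite AG.
  by exists X; rewrite up.
case/forallPn=> A1; rewrite negb_imply -ltnNge ltnS => /andP[A1G small].
(* A loop could be added to its side of the partition for free, turning [A1] into a violation of the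
   condition on [G]. *)
have e1 : r1 [set e] = 1.
  have := rank_unit R1 e set0; rewrite setU0 (rank0 R1); case E1 : (r1 _) => [|[]] // _.
  have [eA1 _] := inGe _ A1G; have := H _ eA1.
  by rewrite (rank_loop _ R1 E1) -D1; lia.
have e2 : r2 [set e] = 1.
  have := rank_unit R2 e set0; rewrite setU0 (rank0 R2); case E2 : (r2 _) => [|[]] // _.
  have [_ eA1] := inGe _ A1G; have := H _ (up _ A1G).
  by rewrite -D2 // (rank_loop _ R2 E2); lia.
have [B BG|X [XG cX X1 X2]] := IH (G :\ e) k _ _ cGe
   (rankfun_contract R1 e1) (rankfun_contract R2 e2); last first.
  have [eXG eX] := inGe _ XG; exists (e |: X); rewrite eXG cardsU1 eX cX.
  have : 0 < r1 (e |: X) by rewrite -e1 rank_mono ?subsetUl.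
  have : 0 < r2 (e |: X) by rewrite -e2 rank_mono ?subsetUl.
  by split=> //; lia.
have [eBG eB] := inGe _ BG; have [eA1G eA1] := inGe _ A1G.
have g1 : 0 < r1 (e |: B) by rewrite -e1 rank_mono ?subsetUl.
have g2 : 0 < r2 (e |: (G :\ e :\: B)) by rewrite -e2 rank_mono ?subsetUl.
have s1 := rank_submod R1 A1 (e |: B).
have s2 := rank_submod R2 (G :\ e :\: A1) (e |: (G :\ e :\: B)).
have i1 : A1 :&: (e |: B) = A1 :&: B.
  by apply/setP=> x; rewrite !inE; case: eqVneq => [->|//]; rewrite (negbTE eA1).
have i2 : (G :\ e :\: A1) :&: (e |: (G :\ e :\: B)) = G :\: (A1 :|: (e |: B)).
  by apply/setP=> x; rewrite !inE; case: eqVneq => //= _;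
     case: (x \in A1); case: (x \in B); case: (x \in G).
have i3 : (G :\ e :\: A1) :|: (e |: (G :\ e :\: B)) = G :\: (A1 :&: B).
  apply/setP=> x; rewrite !inE; case: eqVneq => [->|_] /=.
    by rewrite (negbTE eA1) eG.
  by case: (x \in A1); case: (x \in B); case: (x \in G).
have h1 := H (A1 :&: B) (subset_trans (subsetIl _ _) (up _ A1G)).
have h2 : k.+1 <= r1 (A1 :|: (e |: B)) + r2 (G :\: (A1 :|: (e |: B))).
  by apply: H; rewrite subUset up.
rewrite i1 in s1; rewrite i2 i3 in s2.
by move: s1 s2 h1 h2 small g1 g2; clear; lia.
Qed.

End MatroidIntersection.

(** * Sets that no small set separates from a haven *)

Section FreeSets.
Variables (T : finType) (k : nat) (beta : {set T} -> {set T}).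
Implicit Types (E : rel T) (A B X Z U : {set T}).

(* Sets of more than k vertices block everything, which truncates the rank
   below at k + 1. *)
Definition blocks E A Z : bool :=
  (k < #|Z|) || [forall a in A, (a \notin Z) ==>
                  [forall w in beta Z, ~~ reach (~: Z) E a w]].

Definition rank E A : nat := #|[arg min_(Z < setT | blocks E A Z) #|Z|]|.

Lemma blocks_setT E A : blocks E A setT.
Proof. by apply/orP; right; apply/forall_inP => a _; rewrite inE. Qed.

Lemma rankP E A : exists2 Z, blocks E A Z & #|Z| = rank E A.
Proof. by rewrite /rank; case: (arg_minnP _ (blocks_setT E A)) => Z bZ _; exists Z. Qed.

Lemma rank_min E A Z : blocks E A Z -> rank E A <= #|Z|.
Proof. by rewrite /rank; case: (arg_minnP _ (blocks_setT E A)) => Y _ m /m. Qed.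

Lemma blocks_small E A Z : #|Z| <= k -> blocks E A Z ->
  forall a w, a \in A -> a \notin Z -> w \in beta Z -> ~~ reach (~: Z) E a w.
Proof.
move=> cZ; rewrite /blocks ltnNge cZ /= => /forall_inP b a w aA aZ wZ.
by have := b a aA; rewrite aZ => /forall_inP; apply.
Qed.

Lemma haven_rev E K : haven E K beta -> haven (rev_rel E) K beta.
Proof.
move=> [h1 h2]; split=> // Z /h1[b0 bZ br]; split=> // x y xb yb.
by rewrite reach_rev br.
Qed.

Section Rank.
Variable E : rel T.
Hypothesis hE : haven E (2 * k) beta.

Lemma beta_mono Z Z' : Z \subset Z' -> #|Z'| <= 2 * k -> beta Z' \subset beta Z.
Proof. exact: hE.2. Qed.

Lemma beta_reach Z x y :
  #|Z| <= 2 * k -> x \in beta Z -> y \in beta Z -> reach (~: Z) E x y.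
Proof. by case/hE.1=> _ bZ br xb yb; apply: reach_subset bZ _; apply: br. Qed.

Lemma beta_notin Z x : #|Z| <= 2 * k -> x \in beta Z -> x \notin Z.
Proof. by case/hE.1=> _ /subsetP bZ _ /bZ; rewrite inE. Qed.

(* Uncrossing: the boundaries of the union and of the intersection of the two
   blocked regions. *)
Lemma blocks_uncross A B Za Zb :
  blocks E A Za -> blocks E B Zb -> #|Za| <= k -> #|Zb| <= k ->
  exists Z1 Z2, [/\ blocks E (A :|: B) Z1, blocks E (A :&: B) Z2
                  & #|Z1| + #|Z2| <= #|Za| + #|Zb|].
Proof.
move=> bA bB ca cb.
pose U (C Z : {set T}) := [set v | (v \notin Z) && [exists a in C, (a \notin Z) && reach (~: Z) E a v]].
have UC (C : {set T}) Z v : v \in C -> (v \in U C Z) || (v \in Z).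
  move=> vC; rewrite inE; case: (boolP (v \in Z)) => //= vZ; rewrite orbF.
  by apply/existsP; exists v; rewrite vC vZ reach0.
have UN C Z v w : v \in U C Z -> E v w -> (w \in U C Z) || (w \in Z).
  rewrite !inE => /andP[vZ /existsP[a /and3P[aC aZ av]]] vw.
  case: (boolP (w \in Z)) => //= wZ; rewrite orbF; apply/existsP; exists a.
  by rewrite aC aZ; apply: reach_trans av _; apply: reach1; rewrite ?inE.
have UZ C Z v : v \in U C Z -> v \notin Z by rewrite inE => /andP[].
have Ub C Z v : blocks E C Z -> #|Z| <= k -> v \in U C Z -> v \notin beta Z.
  move=> bC cZ; rewrite inE => /andP[_ /existsP[a /and3P[aC aZ av]]].
  by apply/negP => /(blocks_small cZ bC aC aZ); rewrite av.
set Ua := U A Za; set Ub' := U B Zb.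
pose Z1 := (Za :\: Ub') :|: (Zb :\: Ua).
pose Z2 := (Za :&: Ub') :|: (Zb :&: Ua) :|: (Za :&: Zb).
have cab : #|Za :|: Zb| <= 2 * k by move: (leq_card_setU Za Zb).1 ca cb; clear; lia.
(* [w] lies beyond both separators, hence in neither of the blocked regions. *)
have [b0 _ _] := hE.1 _ cab; case/set0Pn: b0 => w wab.
have wa : w \in beta Za by apply: subsetP wab; apply: beta_mono => //; apply: subsetUl.
have wb : w \in beta Zb by apply: subsetP wab; apply: beta_mono => //; apply: subsetUr.
have wUa : w \notin Ua by apply: contraL wa; apply: Ub.
have wUb : w \notin Ub' by apply: contraL wb; apply: Ub.
(* A region [W] that contains [C] up to [Z], is closed up to [Z] and misses [w] shows that [Z]
   blocks [C], because every vertex of [beta Z] reaches [w]. *)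
have block (C Z W : {set T}) : Z \subset Za :|: Zb ->
    (forall v, v \in C -> (v \in W) || (v \in Z)) ->
    (forall v x, v \in W -> E v x -> (x \in W) || (x \in Z)) -> w \notin W ->
    blocks E C Z.
  move=> sZ CW WN wW; apply/orP; case: (leqP #|Z| k) => [cZ|]; [right|by left].
  apply/forall_inP => a aC; apply/implyP => aZ; apply/forall_inP => x xZ.
  apply: contra wW => ax.
  have aw : reach (~: Z) E a w.
    apply: reach_trans ax _; apply: beta_reach => //; first by move: cZ; clear; lia.
    by apply: subsetP wab; apply: beta_mono.
  apply: (reach_closed _ aw); last by have := CW a aC; rewrite (negbTE aZ) orbF.
  move=> v y /and3P[_ yZ vy] vW; have := WN v y vW vy.
  by rewrite inE in yZ; rewrite (negbTE yZ) orbF.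
exists Z1, Z2; split.
- apply: (block _ _ (Ua :|: Ub')).
  + by apply: setUSS; apply: subsetDl.
  + move=> v; rewrite !(in_setU, in_setI) => /orP[vA|vB].
      by have := UC A Za v vA; rewrite -/Ua !(in_setU, in_setD, in_setI); case: (v \in Ua) => //=; case: (v \in Ub') => //= ->.
    by have := UC B Zb v vB; rewrite -/Ub' !(in_setU, in_setD, in_setI); case: (v \in Ub'); case: (v \in Ua) => //= ->; rewrite orbT.
  + move=> v x; rewrite !(in_setU, in_setI) => /orP[vA|vB] vx.
      by have := UN A Za v x vA vx; rewrite -/Ua !(in_setU, in_setD, in_setI); case: (x \in Ua) => //=; case: (x \in Ub') => //= ->.
    by have := UN B Zb v x vB vx; rewrite -/Ub' !(in_setU, in_setD, in_setI); case: (x \in Ub'); case: (x \in Ua) => //= ->; rewrite orbT.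
  + by rewrite !(in_setU, in_setI) negb_or wUa wUb.
- apply: (block _ _ (Ua :&: Ub')).
  + rewrite !subUset -andbA; apply/and3P; split.
    * by apply: subset_trans (subsetIl _ _) (subsetUl _ _).
    * by apply: subset_trans (subsetIl _ _) (subsetUr _ _).
    * by apply: subset_trans (subsetIl _ _) (subsetUl _ _).
  + move=> v; rewrite !(in_setU, in_setI) => /andP[vA vB].
    have := UC A Za v vA; have := UC B Zb v vB; rewrite -/Ua -/Ub' ?(in_setU, in_setD, in_setI).
    by case: (v \in Ua); case: (v \in Ub'); case: (v \in Za); case: (v \in Zb).
  + move=> v x; rewrite !(in_setU, in_setI) => /andP[vA vB] vx.
    have := UN A Za v x vA vx; have := UN B Zb v x vB vx; rewrite -/Ua -/Ub' ?(in_setU, in_setD, in_setI).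
    by case: (x \in Ua); case: (x \in Ub'); case: (x \in Za); case: (x \in Zb).
  + by rewrite !(in_setU, in_setI) negb_and wUa.
rewrite -(cardsID Ub' Za) -(cardsID Ua Zb).
have c1 : #|Z1| + #|(Za :\: Ub') :&: (Zb :\: Ua)| = #|Za :\: Ub'| + #|Zb :\: Ua|.
  by rewrite cardsUI.
have c2 : #|Z2| <= #|Za :&: Ub'| + #|Zb :&: Ua| + #|Za :&: Zb|.
  apply: leq_trans (leq_card_setU _ _).1 _; rewrite leq_add2r.
  exact: (leq_card_setU _ _).1.
have c3 : Za :&: Zb = (Za :\: Ub') :&: (Zb :\: Ua).
  apply/setP=> v; rewrite in_setI in_setI !in_setD.
  case: (boolP (v \in Ua)) => [/UZ/negbTE ->|_]; first by rewrite !andbF.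
  case: (boolP (v \in Ub')) => [/UZ/negbTE ->|_]; first by rewrite !andbF.
  by [].
by rewrite c3 in c2; move: c1 c2; clear; lia.
Qed.

Lemma blocks_big A Z : k < #|Z| -> blocks E A Z.
Proof. by rewrite /blocks => ->. Qed.

Lemma blocks_sub A B Z : A \subset B -> blocks E B Z -> blocks E A Z.
Proof.
move=> /subsetP AB /orP[|/forall_inP b]; first exact: blocks_big.
by apply/orP; right; apply/forall_inP => a /AB /b.
Qed.

Lemma rankfun_rank : rankfun (rank E).
Proof.
split.
- apply/eqP; rewrite -leqn0 -(cards0 T); apply: rank_min.
  by apply/orP; right; apply/forall_inP => a; rewrite inE.
- move=> A B AB; have [Z bZ <-] := rankP E B.
  by apply: rank_min; apply: blocks_sub bZ.
- move=> e A; have [Z bZ <-] := rankP E A.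
  have ce : #|e |: Z| <= #|Z|.+1 by rewrite cardsU1; case: (_ \notin _); lia.
  apply: leq_trans ce; apply: rank_min.
  case: (leqP #|e |: Z| k) => [cZ|]; last exact: blocks_big.
  have cZ' : #|Z| <= k by apply: leq_trans cZ; rewrite subset_leq_card ?subsetUr.
  apply/orP; right; apply/forall_inP => a; rewrite inE => aeA.
  apply/implyP; rewrite !inE negb_or => /andP[ae aZ]; apply/forall_inP => w wb.
  have aA : a \in A by move: aeA; rewrite inE (negbTE ae).
  have wZ : w \in beta Z by apply: subsetP wb; apply: beta_mono; [exact: subsetUr|lia].
  apply: contra (blocks_small cZ' bZ aA aZ wZ); apply: reach_subset.
  by rewrite setCS subsetUr.
- move=> A B; have [Za bA ea] := rankP E A; have [Zb bB eb] := rankP E B.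
  case: (leqP #|Za| k) => ca; last first.
    have := rank_min (@blocks_big (A :|: B) _ ca).
    have : rank E (A :&: B) <= rank E B.
      by rewrite -eb; apply: rank_min; apply: blocks_sub bB; apply: subsetIr.
    lia.
  case: (leqP #|Zb| k) => cb; last first.
    have := rank_min (@blocks_big (A :|: B) _ cb).
    have : rank E (A :&: B) <= rank E A.
      by rewrite -ea; apply: rank_min; apply: blocks_sub bA; apply: subsetIl.
    lia.
  have [Z1 [Z2 [b1 b2 c12]]] := blocks_uncross bA bB ca cb.
  have := rank_min b1; have := rank_min b2; lia.
Qed.

End Rank.

Definition spread s A : Prop :=
  forall Z, #|Z| < s -> exists2 w, w \in beta Z & w \in A.

Definition free E s X : Prop := #|X| = s /\ rank E X = s /\ rank (rev_rel E) X = s.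

(** If [A1] and the rest of [A] were blocked by [Z1] and [Z2] with fewer than [s] vertices in total,
    a vertex of [A] in [beta (Z1 :|: Z2)] would be unblocked on its own side. So matroid
    intersection yields one set that is free in both directions. *)
Lemma spread_free E s A :
  haven E (2 * k) beta -> s <= k -> spread s A -> exists2 X : {set T}, X \subset A & free E s X.
Proof.
move=> hE sk sA.
have [|X [XA cX X1 X2]] := @matroid_intersection _ (rank E) (rank (rev_rel E)) A s
   (rankfun_rank hE) (rankfun_rank (haven_rev hE)); last by exists X.
move=> A1 A1A; have [Z1 b1 <-] := rankP E A1.
have [Z2 b2 <-] := rankP (rev_rel E) (A :\: A1).
rewrite leqNgt; apply/negP => small.
have c12 : #|Z1 :|: Z2| < s by have := (leq_card_setU Z1 Z2).1; lia.
have [w wb wA] := sA _ c12; have c2k : #|Z1 :|: Z2| <= 2 * k by lia.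
have w1 : w \in beta Z1 by apply: subsetP wb; apply: (beta_mono hE) => //; apply: subsetUl.
have w2 : w \in beta Z2 by apply: subsetP wb; apply: (beta_mono hE) => //; apply: subsetUr.
have := beta_notin hE c2k wb; rewrite inE negb_or => /andP[n1 n2].
have cZ1 : #|Z1| <= k by lia.
have cZ2 : #|Z2| <= k by lia.
case: (boolP (w \in A1)) => wA1.
  by have := blocks_small cZ1 b1 wA1 n1 w1; rewrite reach0.
have wA2 : w \in A :\: A1 by rewrite inE wA1.
by have := blocks_small cZ2 b2 wA2 n2 w2; rewrite reach0.
Qed.

(** Outside [Z], some vertex of [X] reaches [beta Z] and some vertex of [Y] is reached from it,
    while [beta Z] is strongly connected. *)
Lemma free_not_sep E s X Y Z :
  haven E (2 * k) beta -> s <= k -> free E s X -> free E s Y -> #|Z| < s -> ~ sep E X Y Z.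
Proof.
move=> hE sk [_ [X1 _]] [_ [_ Y2]] cZ sZ.
have nb (F : rel T) A : rank F A = s -> ~~ blocks F A Z.
  by move=> rA; apply/negP => /rank_min; rewrite rA; lia.
have out (F : rel T) A : rank F A = s -> exists a w,
    [/\ a \in A, a \notin Z, w \in beta Z & reach (~: Z) F a w].
  move/nb; rewrite negb_or => /andP[_ /forall_inPn[a aA]].
  rewrite negb_imply => /andP[aZ /forall_inPn[w wb /negPn aw]].
  by exists a, w.
have [a [w [aX aZ wb aw]]] := out _ _ X1; have [b [w' [bY bZ w'b bw']]] := out _ _ Y2.
have c2k : #|Z| <= 2 * k by lia.
have /negP[] := sZ a b aX bY aZ bZ.
apply: reach_trans aw _; apply: reach_trans (beta_reach hE c2k wb w'b) _.
by rewrite -reach_rev.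
Qed.

End FreeSets.

(** * A path meeting the haven, cut into pieces with free sets *)

Section HavenNodes.
Variables (T : finType) (E : rel T) (k : nat) (beta : {set T} -> {set T}).
Hypothesis hE : haven E (2 * k) beta.
Implicit Types (Z : {set T}).

Lemma within_path (W : {set T}) x p : path (within W E) x p -> {subset p <= W} /\ path E x p.
Proof.
elim: p x => [|y p IH] x //= /andP[/and3P[_ yW xy] /IH[sW ->]]; rewrite xy; split=> //.
by move=> z; rewrite inE => /orP[/eqP ->|/sW].
Qed.

(** Keep a path that meets some [beta Z0] exactly in its last vertex. If it misses [beta Z'], extend
    it inside [beta Z0] towards a vertex of [beta (Z0 :|: Z')] and stop on entering [beta Z']. It
    stays simple, meets [beta Z'] only at its end, and leaves fewer sets [beta Z] unmet. *)
Lemma haven_path : exists P, [/\ sorted E P, uniq P &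
  forall Z, #|Z| <= k -> exists2 w, w \in beta Z & w \in P].
Proof.
pose unmet (P : seq T) := [set Z : {set T} | (#|Z| <= k) && [forall w in beta Z, w \notin P]].
suff ext n x p Z0 : path E x p -> uniq (x :: p) -> #|Z0| <= k -> last x p \in beta Z0 ->
    (forall v, v \in x :: p -> v \in beta Z0 -> v = last x p) -> #|unmet (x :: p)| < n ->
    exists P, [/\ sorted E P, uniq P & unmet P = set0].
  have c0 : #|@set0 T| <= 2 * k by rewrite cards0.
  have [/set0Pn[x x0] _ _] := hE.1 _ c0.
  have [||||P [sP uP P0]] := ext _ x [::] set0 _ _ _ x0 _ (ltnSn _);
    [by []|by []|by rewrite cards0|by move=> v; rewrite inE => /eqP|].
  exists P; split=> // Z cZ; have : Z \notin unmet P by rewrite P0 inE.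
  by rewrite inE cZ /= => /forall_inPn[w wb /negPn wP]; exists w.
elim: n x p Z0 => // n IH x p Z0 px ux cZ0 lZ0 only lt.
case: (set_0Vmem (unmet (x :: p))) => [e0|[Z']]; first by exists (x :: p).
rewrite inE => /andP[cZ' /forall_inP Z'P].
have cZZ : #|Z0 :|: Z'| <= 2 * k by have := (leq_card_setU Z0 Z').1; lia.
have [/set0Pn[w wb] _ _] := hE.1 _ cZZ.
have w0 : w \in beta Z0 by apply: subsetP wb; apply: hE.2 => //; apply: subsetUl.
have w' : w \in beta Z' by apply: subsetP wb; apply: hE.2 => //; apply: subsetUr.
set v := last x p in lZ0 only *.
have vP : v \in x :: p by apply: mem_last.
have [|_ _ br] := hE.1 Z0; first lia.
case/connectP: (br v w lZ0 w0) => q0 /shortenP[q pq uq _] ew.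
have [qW pqE] := within_path pq.
have hq : has (mem (beta Z')) q.
  case: q pq uq ew qW pqE => [|z q] _ _ ew _ _; last first.
    by apply/hasP; exists w => //; rewrite ew /= mem_last.
  by move: (Z'P w w'); rewrite ew vP.
move: uq qW pqE; case: (split_find hq) => y q1 q2 y' nq1.
rewrite cons_uniq mem_cat negb_or cat_path cat_uniq.
move=> /andP[/andP[vq _] /andP[uq _]] qW /andP[pq1 _].
have P' z : z \in x :: p -> z \notin rcons q1 y.
  move=> zP; apply/negP => zq.
  have e : z = v by apply: only => //; apply: qW; rewrite mem_cat zq.
  by rewrite -e zq in vq.
apply: (IH x (p ++ rcons q1 y) Z') => //.
- by rewrite cat_path px.
- rewrite -cat_cons cat_uniq ux uq andbT; apply/hasPn => z zq.
  by apply/negP => /P'; rewrite zq.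
- by rewrite last_cat last_rcons.
- move=> z; rewrite -cat_cons mem_cat last_cat last_rcons mem_rcons inE.
  case/or3P => [zP z'|/eqP //|zq z']; first by have := Z'P z z'; rewrite zP.
  by case/hasP: nq1; exists z.
- rewrite -ltnS; apply: leq_trans lt; rewrite ltnS; apply: proper_card.
  apply/properP; split.
    apply/subsetP=> Z; rewrite !inE => /andP[-> /forall_inP nZ] /=.
    apply/forall_inP => z /nZ; apply: contra; rewrite -cat_cons mem_cat => ->//.
  exists Z'; first by rewrite inE cZ'; apply/forall_inP.
  rewrite inE cZ' /=; apply/negP => /forall_inP/(_ y y').
  by rewrite -cat_cons mem_cat mem_rcons mem_head orbT.
Qed.

(** A shortest [s]-spread prefix, without its last vertex, misses [beta Z] for some [Z] of fewer
    than [s] vertices. Adding that last vertex gives a set [Z'] of size at most [s] such that the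
    whole prefix misses [beta Y] for every small [Y] containing [Z']. So the remainder meets every
    [beta (Z :|: Z')]. *)
Lemma spread_cut s m (P : seq T) : s + m <= k.+1 ->
  spread beta (s + m) [set v in P] ->
  exists A B, [/\ P = A ++ B, spread beta s [set v in A] & spread beta m [set v in B]].
Proof.
move=> smk sP.
pose spr (A : seq T) := [forall Z : {set T}, (#|Z| < s) ==> [exists w in beta Z, w \in A]].
have sprP A : spr A -> spread beta s [set v in A].
  move=> /forallP sA Z cZ; have := sA Z; rewrite cZ => /existsP[w /andP[wb wA]].
  by exists w; rewrite ?inE.
have ex : exists i, spr (take i P).
  exists (size P); rewrite take_size; apply/forallP=> Z; apply/implyP => cZ.
  have [|w wb] := sP Z; first lia.
  by rewrite inE => wP; apply/existsP; exists w; rewrite wb.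
case: (ex_minnP ex) => i si imin.
exists (take i P), (drop i P); rewrite cat_take_drop; split=> //; first exact: sprP.
have [Z' cZ' Z'P] : exists2 Z' : {set T}, #|Z'| <= s &
    forall (Y : {set T}) w, Z' \subset Y -> #|Y| <= k -> w \in beta Y -> w \notin take i P.
  case: i si imin => [|i] si imin.
    by exists set0; rewrite ?cards0 // => Y w _ _ _; rewrite take0.
  have : ~~ spr (take i P) by apply/negP => /imin; rewrite ltnn.
  case/forallPn=> Z; rewrite negb_imply => /andP[cZ /existsPn nZ].
  case: (ltnP i (size P)) => iP; last first.
    by move: (imin i); rewrite take_oversize // -(@take_oversize _ i.+1 P) ?si ?ltnn; [move/(_ isT)|lia].
  have [y0 _] : exists y0 : T, True by case: P iP {sP ex si imin nZ} => // y ? _; exists y.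
  exists (nth y0 P i |: Z).
    by rewrite cardsU1; case: (_ \notin _); lia.
  move=> Y w; rewrite subUset sub1set => /andP[yY ZY] cY wY.
  rewrite (take_nth y0) // mem_rcons inE negb_or; apply/andP; split.
    have cY2 : #|Y| <= 2 * k by lia.
    by apply: contraL wY => /eqP ->; apply/negP => /(beta_notin hE cY2); rewrite yY.
  have wZ : w \in beta Z by apply: subsetP wY; apply: hE.2 => //; lia.
  by have := nZ w; rewrite wZ.
move=> Z cZ.
have cU : #|Z :|: Z'| < s + m by have := (leq_card_setU Z Z').1; lia.
have [w wb] := sP _ cU; rewrite inE -{1}(cat_take_drop i P) mem_cat => /orP[wt|wd].
  by have := Z'P (Z :|: Z') w (subsetUr _ _); rewrite wt => /(_ ltac:(lia) wb).
exists w; last by rewrite inE.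
by apply: subsetP wb; apply: hE.2; [exact: subsetUl|lia].
Qed.

Lemma spread_pairs s n (P : seq T) : n * (s + s) <= k.+1 -> sorted E P -> uniq P ->
  spread beta (n * (s + s)) [set v in P] ->
  exists L : seq (seq T * seq T), exists rest,
    [/\ size L = n, P = flatten [seq x.1 ++ x.2 | x <- L] ++ rest &
        forall x, x \in L -> [/\ sorted E (x.1 ++ x.2),
           spread beta s [set v in x.1] & spread beta s [set v in x.2]]].
Proof.
elim: n P => [|n IH] P nk sortP uP sP; first by exists [::], P.
have [||A [B [eP sA sB]]] := @spread_cut s (s + n * (s + s)) P; [lia| |].
  by move: sP; rewrite mulSn addnA.
have [||B1 [B2 [eB sB1 sB2]]] := @spread_cut s (n * (s + s)) B; [lia|exact: sB|].
move: sortP uP; rewrite eP eB catA => /cat_sorted2[sAB sB2']; rewrite cat_uniq => /and3P[_ _ uB2].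
have [|L [rest [sL eL allL]]] := IH B2 _ sB2' uB2 sB2; first lia.
exists ((A, B1) :: L), rest; rewrite /= sL {1}eL catA; split=> // x.
by rewrite inE => /orP[/eqP ->|/allL].
Qed.

Lemma flatten_uniq_nth (ss : seq (seq T)) i j v :
  uniq (flatten ss) -> i < size ss -> j < size ss ->
  v \in nth [::] ss i -> v \in nth [::] ss j -> i = j.
Proof.
have mem (ss' : seq (seq T)) l : l < size ss' -> v \in nth [::] ss' l -> v \in flatten ss'.
  by move=> ls vl; apply/flattenP; exists (nth [::] ss' l) => //; apply: mem_nth.
elim: ss i j => // s ss IH [|i] [|j] //=; rewrite cat_uniq => /and3P[_ /hasPn ns us].
- by move=> _ js vs /mem-/(_ js)/ns; rewrite /= vs.
- by move=> is' _ /mem-/(_ is')/ns /= vs vs'; rewrite vs' in vs.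
- by move=> is' js vi vj; rewrite (IH i j).
Qed.

(** Each piece is a spread segment followed by another one; [pt] is the last vertex of the first
    segment, so it is reached from all of the first and reaches all of the second. *)
Lemma haven_nodes s n : 0 < s -> n * (s + s) <= k ->
  exists (P A B : 'I_n -> {set T}) (pt : 'I_n -> T),
  [/\ forall i j v, v \in P i -> v \in P j -> i = j,
      forall i, pt i \in P i,
      forall i, [/\ A i \subset P i, B i \subset P i, free k beta E s (A i) & free k beta E s (B i)],
      forall i v, v \in A i -> reach (P i) E v (pt i)
    & forall i v, v \in B i -> reach (P i) E (pt i) v].
Proof.
move=> s0 nk; have [Q [sQ uQ Qm]] := haven_path.
have [|//|//||L [rest [sL eL allL]]] := @spread_pairs s n Q; [lia| |].
  move=> Z cZ; have [|w wb wQ] := Qm Z; first lia.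
  by exists w; rewrite ?inE.
case: n nk sL => [|n] nk sL.
  have f0 (R : Type) : 'I_0 -> R by case.
  by exists (f0 _), (f0 _), (f0 _), (f0 _); split; case.
have sk : s <= k by lia.
have /fin_all_exists[f fP] (i : 'I_n.+1) : exists d : {set T} * {set T} * T,
  let x := nth ([::], [::]) L i in let Pi := [set v in x.1 ++ x.2] in
  [/\ d.2 \in Pi, [/\ d.1.1 \subset Pi, d.1.2 \subset Pi, free k beta E s d.1.1
    & free k beta E s d.1.2],
    forall v, v \in d.1.1 -> reach Pi E v d.2 & forall v, v \in d.1.2 -> reach Pi E d.2 v].
  have /allL : nth ([::], [::]) L i \in L by apply: mem_nth; rewrite sL.
  case: (nth _ L i) => A B /= [sAB sA sB].
  have [A' A'A fA] := spread_free hE sk sA; have [B' B'B fB] := spread_free hE sk sB.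
  case: A sAB sA A'A => [|a A] sAB sA A'A.
    by have [|w _] := sA set0; rewrite ?cards0 // inE.
  exists (A', B', last a A) => /=; move: sAB; rewrite /= cat_path => /andP[pA pB].
  have [_ _ tA] := path_thread pA; have [_ _ tB] := path_thread pB.
  have sub1 : [set v in a :: A] \subset [set v in a :: A ++ B].
    by apply/subsetP=> v; rewrite !inE mem_cat => /orP[->|->] //; rewrite orbT.
  have sub2 : [set v in last a A :: B] \subset [set v in a :: A ++ B].
    apply/subsetP=> v; rewrite !inE mem_cat => /orP[/eqP ->|->]; rewrite ?orbT //.
    by have := mem_last a A; rewrite inE => /orP[->|->]; rewrite ?orbT.
  split.
  - by apply: (subsetP sub2); rewrite inE mem_head.
  - split=> //; first exact: subset_trans A'A sub1.
    apply: subset_trans B'B _; apply: subset_trans sub2.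
    by apply/subsetP=> v; rewrite !inE => ->; rewrite orbT.
  - move=> v vA; apply: reach_subset sub1 _; apply: (tA v _).2.
    exact: (subsetP A'A).
  - move=> v vB; apply: reach_subset sub2 _; apply: (tB v _).1.
    by have := subsetP B'B v vB; rewrite !inE => ->; rewrite orbT.
exists (fun i => [set v in (nth ([::], [::]) L i).1 ++ (nth ([::], [::]) L i).2]),
  (fun i => (f i).1.1), (fun i => (f i).1.2), (fun i => (f i).2).
split; try by move=> i; case: (fP i).
move=> i j v; rewrite !inE => vi vj.
have := @flatten_uniq_nth [seq x.1 ++ x.2 | x <- L] i j v.
rewrite size_map sL !(nth_map ([::], [::])) ?sL // => /(_ _ (ltn_ord i) (ltn_ord j) vi vj) e.
by apply: val_inj; apply: e; move: uQ; rewrite eL cat_uniq => /andP[].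
Qed.

End HavenNodes.

(** * Random choices and counting *)

Section FirstMoment.
Variables (L X : finType).

(** The involution [h] exchanges the values of [phi] at [l] and [m] with a separate pair, so these
    two values of a uniform [phi] are independent and uniform. *)
Lemma sum_two_coords (l m : L) (g : X -> X -> nat) : m != l ->
  #|X| ^ 2 * (\sum_(phi : {ffun L -> X}) g (phi l) (phi m)) =
  #|{ffun L -> X}| * \sum_x \sum_y g x y.
Proof.
move=> ml.
pose h (d : {ffun L -> X} * (X * X)) : {ffun L -> X} * (X * X) :=
  ([ffun n => if n == l then d.2.1 else if n == m then d.2.2 else d.1 n], (d.1 l, d.1 m)).
have hK : involutive h.
  case=> phi [x y]; rewrite /h /= !ffunE eqxx (negbTE ml) eqxx; congr (_, _).
  by apply/ffunP => n; rewrite !ffunE; case: eqVneq => [->//|_]; case: eqVneq => [->|].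
have e1 : \sum_(d : {ffun L -> X} * (X * X)) g (d.1 l) (d.1 m) =
    #|X| ^ 2 * (\sum_(phi : {ffun L -> X}) g (phi l) (phi m)).
  rewrite -(pair_bigA _ (fun (phi : {ffun L -> X}) (_ : X * X) => g (phi l) (phi m))) /=.
  rewrite big_distrr /=; apply: eq_bigr => phi _.
  by rewrite sum_nat_const card_prod.
have e2 : \sum_(d : {ffun L -> X} * (X * X)) g d.2.1 d.2.2 =
    #|{ffun L -> X}| * \sum_x \sum_y g x y.
  rewrite -(pair_bigA _ (fun (_ : {ffun L -> X}) (d : X * X) => g d.1 d.2)) /=.
  by rewrite sum_nat_const pair_bigA.
rewrite -e1 -e2 (reindex_inj (inv_inj hK)) /=.
by apply: eq_bigr => [[phi [x y]]] _ /=; rewrite !ffunE eqxx (negbTE ml) eqxx.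
Qed.

Lemma first_moment (f : L -> L -> X -> X -> nat) : 0 < #|X| ->
  exists phi : {ffun L -> X},
    #|X| ^ 2 * (\sum_l \sum_(m | m != l) f l m (phi l) (phi m)) <=
    \sum_l \sum_(m | m != l) \sum_x \sum_y f l m x y.
Proof.
move=> X0; pose R := \sum_l \sum_(m | m != l) \sum_x \sum_y f l m x y.
pose cost (phi : {ffun L -> X}) := \sum_l \sum_(m | m != l) f l m (phi l) (phi m).
apply/existsP; apply: contraT => /existsPn big.
have tot : \sum_(phi : {ffun L -> X}) #|X| ^ 2 * cost phi = #|{ffun L -> X}| * R.
  rewrite -big_distrr /= /cost exchange_big /= big_distrr /R big_distrr /=.
  apply: eq_bigr => l _; rewrite exchange_big /= !big_distrr /=.
  by apply: eq_bigr => m ml; rewrite sum_two_coords.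
have F0 : 0 < #|{ffun L -> X}| by rewrite card_ffun expn_gt0 X0.
have : \sum_(phi : {ffun L -> X}) R.+1 <= \sum_(phi : {ffun L -> X}) #|X| ^ 2 * cost phi.
  by apply: leq_sum => phi _; have := big phi; rewrite -ltnNge.
by rewrite tot sum_nat_const leq_pmul2l // ltnn.
Qed.

End FirstMoment.

Lemma leq_cards1 (I : finType) (A : {set I}) :
  {in A &, forall i j, i = j} -> #|A| <= 1.
Proof. by move=> h; apply/card_le1_eqP => i j iA jA; apply: h. Qed.

Lemma sum_card_fibers (I J : finType) (B : {set I * J}) :
  \sum_i #|[set j | (i, j) \in B]| = #|B|.
Proof.
rewrite -sum1_card (eq_bigr (fun i => \sum_(j | (i, j) \in B) 1)); last first.
  by move=> i _; rewrite -sum1_card; apply: eq_bigl => j; rewrite inE.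
by rewrite pair_big_dep /=; apply: eq_bigl => [[i j]].
Qed.

Lemma many_small (I : finType) (f : I -> nat) c :
  #|[set i | c < f i]| * c.+1 <= \sum_i f i.
Proof.
rewrite -sum_nat_const [X in _ <= X](bigID (mem [set i | c < f i])) /=.
apply: leq_trans (leq_addr _ _); apply: leq_sum => i; by rewrite inE.
Qed.

Lemma card_meet (I T : finType) (A : {set I}) (Z : {set T}) (F : I -> {set T}) :
  {in A, forall x, F x :&: Z != set0} ->
  (forall x y v, x \in A -> y \in A -> v \in F x -> v \in F y -> x = y) -> #|A| <= #|Z|.
Proof.
move=> hit dj.
(* [option T] provides a value outside [A] even when [T] is empty. *)
have /fin_all_exists[z zP] (x : I) : exists z : option T, x \in A ->
    exists2 v, z = Some v & v \in F x :&: Z.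
  case xA : (x \in A); last by exists None.
  by have /set0Pn[v vF] := hit x xA; exists (Some v) => _; exists v.
have zI : {in A &, injective z}.
  move=> x y xA yA; have [v -> /setIP[vx _]] := zP x xA.
  have [w -> /setIP[wy _]] := zP y yA => -[e]; rewrite -e in wy; exact: dj vx wy.
have SomeI : injective (@Some T) by move=> x y [].
rewrite -(card_in_imset zI) -(card_imset _ SomeI); apply: subset_leq_card.
apply/subsetP=> _ /imsetP[x xA ->]; have [v -> /setIP[_ vZ]] := zP x xA.
by apply: imset_f.
Qed.

Definition conflicts (T : finType) s (A B : 'I_s -> {set T}) : nat :=
  \sum_x \sum_y (A x :&: B y != set0).

(** * Packing when all pairs of linkages rarely intersect *)

Section Sparse.
Variables (T : finType) (E : rel T) (a b s : nat).
Hypotheses (a0 : 0 < a) (b0 : 0 < b) (s0 : 0 < s).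
Notation m := (16 * b).
Notation link := ('I_(2 * a) * ('I_m * 'I_m))%type.
Variables (P : 'I_(2 * a) * 'I_m -> {set T}) (pt : 'I_(2 * a) * 'I_m -> T).
Variable (Q : link -> 'I_s -> {set T}).
Hypothesis Pdisj : forall i j v, v \in P i -> v \in P j -> i = j.
Hypothesis ptP : forall i, pt i \in P i.
Hypothesis PQ : forall g i j x,
  reach (P (g, i) :|: Q (g, (i, j)) x :|: P (g, j)) E (pt (g, i)) (pt (g, j)).

Hypothesis sparse : forall l l', l' != l ->
  256 * #|{: link}| * conflicts (Q l) (Q l') <= s ^ 2.

Lemma sparse_packing : exists Vs : 'I_a -> {set T},
  (forall v, #|[set i | v \in Vs i]| <= 2) /\ forall i, dtw_ge (Vs i) E b.
Proof.
pose f l l' x y : nat := Q l x :&: Q l' y != set0.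
have [|phi] := @first_moment link 'I_s f; first by rewrite card_ord.
rewrite card_ord; set C := \sum_l _ => hC.
have sp := sparse; set r := #|{: link}| in sp.
have rE : r = 2 * a * (m * m) by rewrite /r !card_prod !card_ord.
(* [C] counts the ordered pairs of distinct links whose chosen paths meet; averaging bounds it by
   [r / 256]. *)
have C256 : 256 * C <= r.
  have r0 : 0 < r by rewrite rE !muln_gt0 a0 b0.
  have : 256 * r * (s ^ 2 * C) <= r * (r * s ^ 2).
    apply: leq_trans (leq_mul (leqnn _) hC) _.
    rewrite big_distrr -sum_nat_const /=; apply: leq_sum => l _.
    rewrite big_distrr /= -sum_nat_const [X in _ <= X](bigID (fun l' => l' != l)) /=.
    by apply: leq_trans (leq_addr _ _); apply: leq_sum => l' /sp.
  have -> : 256 * r * (s ^ 2 * C) = (r * s ^ 2) * (256 * C) by lia.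
  have -> : r * (r * s ^ 2) = (r * s ^ 2) * r by lia.
  by rewrite leq_pmul2l // muln_gt0 r0 expn_gt0 s0.
pose q l := Q l (phi l).
pose bad := [set l : link | [exists l', (l' != l) && (q l :&: q l' != set0)]].
have cbad : #|bad| <= C.
  rewrite -sum1_card /C big_mkcond /=; apply: leq_sum => l _.
  case: ifP => //; rewrite inE => /existsP[l' /andP[l'l hit]].
  by rewrite (bigD1 l') //= /f hit.
pose badg g := #|[set ij | (g, ij) \in bad]|.
have sbad : \sum_g badg g = #|bad| by apply: sum_card_fibers.
(* At most [r / 256], that is [2 * a * b ^ 2], links are bad, so fewer than [a] of the [2 * a]
   groups contain more than [2 * b ^ 2] of them. *)
pose good := [set g | badg g <= 2 * b * b].
have cgood : a <= #|good|.
  have := many_small badg (2 * b * b); rewrite sbad.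
  have : #|good| + #|[set g | 2 * b * b < badg g]| = 2 * a.
    rewrite -[RHS]card_ord -(cardC good) -cardsE; congr (_ + _).
    by apply: eq_card => g; rewrite !inE -ltnNge.
  move: cbad C256; rewrite rE; clear -b0; nia.
pose ga (i : 'I_a) : 'I_(2 * a) := enum_val (widen_ord cgood i).
have gaI : injective ga by move=> i j /enum_val_inj/(congr1 val) /= e; apply: val_inj.
have gagood i : badg (ga i) <= 2 * b * b.
  by have := enum_valP (widen_ord cgood i); rewrite inE.
pose VP i := \bigcup_j P (ga i, j).
pose VQ i := \bigcup_(ij | (ga i, ij) \notin bad) q (ga i, ij).
have qdisj l l' v : l \notin bad -> v \in q l -> v \in q l' -> l = l'.
  rewrite inE => /existsPn nb vl vl'; apply/eqP; apply: contraT => ll'.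
  have := nb l'; rewrite eq_sym ll' negbK => /eqP/setP/(_ v).
  by rewrite !inE vl vl'.
exists (fun i => VP i :|: VQ i); split=> [v|i].
  have -> : [set i | v \in VP i :|: VQ i] = [set i | v \in VP i] :|: [set i | v \in VQ i].
    by apply/setP=> i; rewrite !inE.
  apply: leq_trans (leq_card_setU _ _).1 _; rewrite -[2]/(1 + 1); apply: leq_add;
    apply: leq_cards1 => i j; rewrite !inE => /bigcupP[x xb vx] /bigcupP[y yb vy].
    by have [/gaI] := Pdisj vx vy.
  by have [/gaI] := qdisj _ _ _ xb vx vy.
set g := ga i; set V := VP i :|: VQ i.
(* At most [b] nodes die and at most [b * (2 * b + 1)] links are broken, so at most [b] nodes have
   more than [2 * b] broken outgoing links. At least [14 * b] of the [16 * b] nodes remain, enough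
   for a loss of [2 * b]. *)
apply: (@dtw_ge_reach T 'I_m V E b setT (fun j => pt (g, j)) (2 * b)) => Z cZ.
pose dead := [set j | P (g, j) :&: Z != set0].
pose killed := [set ij | ((g, ij) \notin bad) && (q (g, ij) :&: Z != set0)].
pose broken := [set ij | (g, ij) \in bad] :|: killed.
have cdead : #|dead| <= b.
  apply: leq_trans cZ; apply: (@card_meet _ _ _ _ (fun j => P (g, j))); first by move=> j; rewrite inE.
  by move=> x y v _ _ vx vy; have [] := Pdisj vx vy.
have ckilled : #|killed| <= b.
  apply: leq_trans cZ; apply: (@card_meet _ _ _ _ (fun ij => q (g, ij))); first by move=> j; rewrite inE => /andP[].
  by move=> x y v; rewrite inE => /andP[xb _] _ vx vy; have [] := qdisj _ _ _ xb vx vy.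
have cbroken : #|broken| <= b * (2 * b + 1).
  apply: leq_trans (leq_card_setU _ _).1 _; have := gagood i; rewrite /badg -/g.
  move: ckilled; move: #|killed| #|[set ij | _]| => x y; clear; nia.
pose deg (j : 'I_m) := #|[set l | (j, l) \in broken]|.
pose G := [set j | (j \notin dead) && (deg j <= 2 * b)].
have cdeg : #|[set j | 2 * b < deg j]| <= b.
  have := many_small deg (2 * b); rewrite sum_card_fibers => h.
  have := leq_trans h cbroken; rewrite addn1 leq_pmul2r //.
have cG : 14 * b <= #|G|.
  have : #|~: G| <= 2 * b.
    have : ~: G \subset dead :|: [set j | 2 * b < deg j].
      apply/subsetP=> j; rewrite in_setC in_setU [j \in G]inE negb_and negbK -ltnNge.
      by rewrite [j \in [set _ | _]]inE.
    move/subset_leq_card => h; apply: leq_trans h _.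
    by apply: leq_trans (leq_card_setU _ _).1 _; move: cdead cdeg; clear; lia.
  have := cardsC G; rewrite card_ord; move: #|G| #|~: G| => x y; clear; lia.
have PV j : P (g, j) \subset V.
  by apply: subset_trans (subsetUl _ _); apply: (bigcup_sup j).
have PZ j : j \in G -> P (g, j) \subset V :\: Z.
  rewrite inE => /andP[jd _]; rewrite subsetD PV /=; move: jd.
  by rewrite inE negbK setI_eq0.
exists G; split.
- exact: subsetT.
- by rewrite cardsT card_ord; move: cG b0; move: #|G| => x; clear; lia.
- by move=> j jG; apply: (subsetP (PZ j jG)).
- move=> j jG; move: (jG); rewrite [j \in G]inE => /andP[_ dj]; apply: leq_trans dj.
  apply: subset_leq_card; apply/subsetP => l; rewrite in_set => /andP[lG].
  apply: contraR => nbr; rewrite in_set in nbr.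
  apply: reach_subset (PQ g j l (phi (g, (j, l)))).
  rewrite !subUset (PZ j jG) (PZ l lG) andbT /=.
  move: nbr; rewrite in_setU negb_or !inE => /andP[nb].
  rewrite nb /= negbK => /eqP qZ.
  rewrite subsetD -setI_eq0 qZ eqxx andbT; apply: subset_trans (subsetUr _ _).
  by apply: (bigcup_sup (j, l)); rewrite // inE.
Qed.

End Sparse.

(** * Blocks almost invariant under a permutation *)

Section Blocks.
Variables (R : finType) (nu : R -> R).

Definition exits (A : {set R}) : {set R} := [set x in A | nu x \notin A].

(** Follow the cycles of [nu]: append the image of the only exit, or any new element when there is
    none. The appended element is then the only possible exit. *)
Lemma exits_chain n : n <= #|R| -> exists l : seq R,
  [/\ uniq l, size l = n & forall i, i <= n -> #|exits [set x in take i l]| <= 1].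
Proof.
elim: n => [_|n IH lt].
  exists [::]; split=> // i _; rewrite (_ : exits _ = set0) ?cards0 //.
  by apply/setP=> x; rewrite !inE.
have [l [ul sl le]] := IH (ltnW lt).
have ln := le n (leqnn n); rewrite -sl take_size in ln.
suff [y yl ye] : exists2 y, y \notin l & exits [set x in rcons l y] \subset [set y].
  exists (rcons l y); rewrite rcons_uniq yl ul size_rcons sl; split=> // i.
  rewrite leq_eqVlt => /orP[/eqP ->|lti].
    rewrite -{1}sl -(size_rcons l y) take_size -(cards1 y); exact: subset_leq_card.
  have il : i <= size l by rewrite sl -ltnS.
  by rewrite -cats1 takel_cat // le // -sl.
case: (set_0Vmem (exits [set x in l])) => [e0|[x]].
  have [y yl] : exists y, y \notin l.
    apply/existsP; rewrite -negb_forall; apply/negP => /forallP all.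
    by have := card_uniqP ul; rewrite sl (@eq_card _ _ predT) // => h; rewrite h ltnn in lt.
  exists y => //; apply/subsetP=> z; rewrite !inE mem_rcons inE => /andP[/orP[//|zl]].
  rewrite mem_rcons inE negb_or => /andP[_ nz].
  have ze : z \in exits [set x in l] by rewrite !inE zl nz.
  by rewrite e0 inE in ze.
move=> xe; move: (xe); rewrite !inE => /andP[xl nx]; exists (nu x) => //.
apply/subsetP=> z; rewrite !inE mem_rcons inE => /andP[/orP[//|zl]].
rewrite mem_rcons inE negb_or => /andP[nzx nz].
have ze : z \in exits [set x in l] by rewrite !inE zl nz.
by move/card_le1_eqP: ln => /(_ _ _ xe ze) e; rewrite e eqxx in nzx.
Qed.

Lemma entries_exits (A : {set R}) : injective nu ->
  #|[set x | (x \notin A) && (nu x \in A)]| = #|exits A|.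
Proof.
move=> nuI; have := card_preimset A nuI.
rewrite -(cardsID A (nu @^-1: A)) -(cardsID (nu @^-1: A) A) setIC.
move/eqP; rewrite eqn_add2l => /eqP.
rewrite (_ : nu @^-1: A :\: A = [set x | (x \notin A) && (nu x \in A)]); last first.
  by apply/setP=> x; rewrite !inE.
move=> ->; congr #|pred_of_set _|; by apply/setP=> x; rewrite !inE andbC.
Qed.

(** Blocks are intervals of the enumeration. An exit of an interval is an exit of the longer prefix
    or an entry into the shorter one, and injectivity makes entries as rare as exits. *)
Lemma perm_blocks p w : injective nu -> #|R| = p * w -> exists blk : R -> 'I_p,
  forall t, #|[set x | blk x == t]| = w /\ #|exits [set x | blk x == t]| <= 2.
Proof.
move=> nuI cR; have [l [ul sl le]] := exits_chain (leqnn #|R|).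
have lall x : x \in l.
  have : [set x in l] = setT.
    by apply/eqP; rewrite eqEcard subsetT cardsT cardsE (card_uniqP ul) sl leqnn.
  by move/setP/(_ x); rewrite !inE.
have idx x : index x l < p * w by rewrite -cR -sl index_mem.
have blkP x : index x l %/ w < p.
  by have := idx x; case: (posnP w) => [->|w0]; [rewrite muln0|rewrite ltn_divLR].
pose A i := [set x in take i l].
have AE i x : (x \in A i) = (index x l < i) by rewrite inE in_take.
have cA i : i <= #|R| -> #|A i| = i.
  by move=> iR; rewrite cardsE (card_uniqP (take_uniq _ ul)) size_takel ?sl.
exists (fun x => Ordinal (blkP x)) => t.
have tp : t.+1 * w <= #|R| by rewrite cR leq_mul2r (ltn_ord t) orbT.
have twp : t * w <= #|R| by apply: leq_trans tp; rewrite leq_mul2r leqnSn orbT.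
have bE : [set x | Ordinal (blkP x) == t] = A (t.+1 * w) :\: A (t * w).
  apply/setP=> x; rewrite in_setD !AE inE -leqNgt -val_eqE /= eqn_leq.
  case: (posnP w) => [w0|w0].
    by have := idx x; rewrite w0 muln0.
  by rewrite leq_divRL // -ltnS ltn_divLR // andbC.
have AA : A (t * w) \subset A (t.+1 * w).
  by apply/subsetP=> x; rewrite !AE => /leq_trans; apply; rewrite leq_mul2r leqnSn orbT.
rewrite bE; split; first by rewrite cardsD (setIidPr AA) !cA // mulSn addnK.
have : exits (A (t.+1 * w) :\: A (t * w)) \subset
  exits (A (t.+1 * w)) :|: [set x | (x \notin A (t * w)) && (nu x \in A (t * w))].
  apply/subsetP=> x; rewrite in_set in_setD in_setU /exits !in_set.
  by rewrite negb_and negbK => /andP[/andP[-> ->]] /orP[->|->]; rewrite ?orbT.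
move/subset_leq_card => h; apply: leq_trans h _.
apply: leq_trans (leq_card_setU _ _).1 _; rewrite entries_exits //.
by rewrite -[2]/(1 + 1); apply: leq_add; apply: le.
Qed.

End Blocks.

Lemma card_split (I J : finType) (f : I -> J) (A : {set I}) :
  \sum_t #|[set x in A | f x == t]| = #|A|.
Proof.
rewrite -sum1_card (partition_big f predT) //=; apply: eq_bigr => t _.
by rewrite -sum1_card; apply: eq_bigl => x; rewrite inE.
Qed.

(** * Greedy choice of dense pairs of blocks *)

Section Cells.
Variables (s p w a D R0 : nat) (H : rel 'I_s) (bX bY : 'I_s -> 'I_p).
Hypotheses (a0 : 0 < a) (sE : s = p * w) (pE : p = 4 * a * R0) (wE : w = 4 * D * R0).
Hypothesis cX : forall t, #|[set x | bX x == t]| = w.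
Hypothesis cY : forall t, #|[set y | bY y == t]| = w.

Definition cell t u : {set 'I_s * 'I_s} :=
  [set xy | [&& H xy.1 xy.2, bX xy.1 == t & bY xy.2 == u]].

Hypothesis dense : s ^ 2 < R0 * #|[set xy : 'I_s * 'I_s | H xy.1 xy.2]|.

Lemma cell_row_sum t : \sum_u #|cell t u| <= w * s.
Proof.
pose A := [set xy : 'I_s * 'I_s | H xy.1 xy.2 && (bX xy.1 == t)].
rewrite (eq_bigr (fun u => #|[set xy in A | bY xy.2 == u]|)); last first.
  by move=> u _; congr #|pred_of_set _|; apply/setP=> xy; rewrite !inE andbA.
rewrite (card_split (fun xy : 'I_s * 'I_s => bY xy.2) A).
rewrite -(cX t) -[X in _ * X]card_ord -cardsT -cardsX; apply: subset_leq_card.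
by apply/subsetP=> xy; rewrite !inE andbT => /andP[].
Qed.

Lemma cell_col_sum u : \sum_t #|cell t u| <= w * s.
Proof.
pose A := [set xy : 'I_s * 'I_s | H xy.1 xy.2 && (bY xy.2 == u)].
rewrite (eq_bigr (fun t => #|[set xy in A | bX xy.1 == t]|)); last first.
  by move=> t _; congr #|pred_of_set _|; apply/setP=> xy; rewrite !inE -andbA [(bX _ == _) && _]andbC.
rewrite (card_split (fun xy : 'I_s * 'I_s => bX xy.1) A).
rewrite mulnC -(cY u) -[X in X * _]card_ord -cardsT -cardsX; apply: subset_leq_card.
by apply/subsetP=> xy; rewrite !inE /= => /andP[].
Qed.

Lemma cell_sum : \sum_t \sum_u #|cell t u| = #|[set xy : 'I_s * 'I_s | H xy.1 xy.2]|.
Proof.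
rewrite -(card_split (fun xy : 'I_s * 'I_s => bX xy.1)); apply: eq_bigr => t _.
rewrite -(card_split (fun xy : 'I_s * 'I_s => bY xy.2)); apply: eq_bigr => u _.
by congr #|pred_of_set _|; apply/setP=> xy; rewrite !inE andbA.
Qed.

(** Choose cells greedily in new rows and columns. If this stops early, the used rows and columns
    hold at most half of [s ^ 2 / R0] pairs, and so do the other cells, each with fewer than
    [2 * D * w]; this contradicts [dense]. *)
Lemma dense_cells : exists (tX tY : 'I_a -> 'I_p),
  [/\ injective tX, injective tY & forall i, 2 * D * w <= #|cell (tX i) (tY i)|].
Proof.
suff [l [sl u1 u2 big]] : exists l : seq ('I_p * 'I_p),
    [/\ size l = a, uniq [seq c.1 | c <- l], uniq [seq c.2 | c <- l] &
        forall c, c \in l -> 2 * D * w <= #|cell c.1 c.2|].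
  case: l sl u1 u2 big => [sl|c0 l sl u1 u2 big]; first by move: a0; rewrite -sl.
  exists (fun i : 'I_a => (nth c0 (c0 :: l) i).1), (fun i : 'I_a => (nth c0 (c0 :: l) i).2).
  split.
  - move=> i j; rewrite -!(nth_map c0 c0.1 (fun c => c.1)) ?sl // => /eqP.
    by rewrite nth_uniq ?size_map ?sl // => /eqP /val_inj.
  - move=> i j; rewrite -!(nth_map c0 c0.2 (fun c => c.2)) ?sl // => /eqP.
    by rewrite nth_uniq ?size_map ?sl // => /eqP /val_inj.
  - by move=> i; apply: big; apply: mem_nth; rewrite sl.
have : a <= a by []; move: {-2}a; elim=> [|j IH] ja; first by exists [::].
have [l [sl u1 u2 big]] := IH (ltnW ja).
case: (pickP [pred c : 'I_p * 'I_p | [&& c.1 \notin [seq c.1 | c <- l],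
   c.2 \notin [seq c.2 | c <- l] & 2 * D * w <= #|cell c.1 c.2|]]) => [c /and3P[c1 c2 cb]|none].
  exists (c :: l); rewrite /= sl c1 c2 u1 u2; split=> // d.
  by rewrite inE => /orP[/eqP ->|/big].
have bound t u : #|cell t u| <= (t \in [seq c.1 | c <- l]) * #|cell t u| +
    (u \in [seq c.2 | c <- l]) * #|cell t u| + 2 * D * w.
  case: (boolP (t \in _)) => t1; first by rewrite mul1n -addnA leq_addr.
  case: (boolP (u \in _)) => u2'; first by rewrite mul1n -addnA addnCA leq_addr.
  by have := none (t, u); rewrite /= t1 u2' /= => /negbT; rewrite -ltnNge => /ltnW.
have tot : \sum_t \sum_u #|cell t u| <=
    j * (w * s) + j * (w * s) + p * (p * (2 * D * w)).
  have -> : p * (p * (2 * D * w)) = \sum_(t < p) \sum_(u < p) 2 * D * w.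
    by rewrite !sum_nat_const !card_ord.
  apply: (@leq_trans (\sum_t \sum_u ((t \in [seq c.1 | c <- l]) * #|cell t u| +
    (u \in [seq c.2 | c <- l]) * #|cell t u| + 2 * D * w))).
    by apply: leq_sum => t _; apply: leq_sum => u _.
  rewrite (eq_bigr (fun t => \sum_u ((t \in [seq c.1 | c <- l]) * #|cell t u| +
    (u \in [seq c.2 | c <- l]) * #|cell t u|) + \sum_(u < p) 2 * D * w)); last first.
    by move=> t _; rewrite big_split.
  rewrite big_split leq_add2r /=.
  rewrite (eq_bigr (fun t => \sum_u (t \in [seq c.1 | c <- l]) * #|cell t u| +
    \sum_u (u \in [seq c.2 | c <- l]) * #|cell t u|)); last first.
    by move=> t _; rewrite big_split.
  rewrite big_split /=.
  have mark (r : seq 'I_p) (f : 'I_p -> nat) : uniq r -> (forall t, f t <= w * s) ->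
      \sum_t (t \in r) * f t <= size r * (w * s).
    move=> ur fb; rewrite -(card_uniqP ur) -sum_nat_const [X in _ <= X]big_mkcond /=.
    apply: leq_sum => t _; case: (t \in r) => //=; by rewrite mul1n.
  apply: leq_add.
    rewrite -{1}sl -(size_map (fun c => c.1)).
    rewrite (eq_bigr (fun t => (t \in [seq c.1 | c <- l]) * \sum_u #|cell t u|)).
      by apply: mark => // t; apply: cell_row_sum.
    by move=> t _; rewrite big_distrr.
  rewrite -{1}sl -(size_map (fun c => c.2)) exchange_big /=.
  rewrite (eq_bigr (fun u => (u \in [seq c.2 | c <- l]) * \sum_t #|cell t u|)).
    by apply: mark => // t; apply: cell_col_sum.
  by move=> t _; rewrite big_distrr.
exfalso; move: dense; rewrite -cell_sum ltnNge => /negP; apply.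
apply: leq_trans (leq_mul (leqnn R0) tot) _.
(* This half uses [j < a] and the value of [p]; the next one uses the value of [w]. *)
have : R0 * (j * (w * s) + j * (w * s)) * 2 <= s ^ 2.
  have -> : s ^ 2 = (4 * a * R0) * (w * s) by rewrite {1}sE pE; lia.
  rewrite !mulnA; nia.
have : R0 * (p * (p * (2 * D * w))) * 2 = s ^ 2.
  have -> : s ^ 2 = p * p * w * (4 * D * R0) by rewrite -wE sE; lia.
  lia.
lia.
Qed.

End Cells.

(** * Highly connected parts of dense graphs *)

Section Inseparable.
Variables (I : finType) (H : rel I).
Implicit Types (S U C : {set I}).

Definition edges S : {set I * I} := [set xy | [&& xy.1 \in S, xy.2 \in S & H xy.1 xy.2]].

Lemma card_edges S : #|edges S| <= #|S| ^ 2.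
Proof.
rewrite -[_ ^ 2]/(#|S| * #|S|) -cardsX; apply: subset_leq_card.
by apply/subsetP=> xy; rewrite !inE => /and3P[-> ->].
Qed.

(* Mader's argument: a smallest set with at least D(|S| - q) edges has no
   separation of order at most q. *)
Lemma inseparable_subset D q S0 : 2 * q ^ 2 < D -> q < #|S0| ->
  D * (#|S0| - q) <= #|edges S0| ->
  exists S, [/\ S \subset S0, q < #|S|, D * (#|S| - q) <= #|edges S| &
    forall C U, #|C| <= q ->
      (forall x y, x \in S -> y \in S -> x \notin C -> y \notin C ->
         x \in U -> y \notin U -> ~~ H x y && ~~ H y x) ->
      forall x y, x \in S -> x \notin C -> x \in U -> y \in S -> y \notin C -> y \in U].
Proof.
move=> Dq; have [n] := ubnP #|S0|; elim: n S0 => // n IH S0 cn qS0 eS0.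
case: (boolP [exists S : {set I}, [&& S \proper S0, q < #|S| & D * (#|S| - q) <= #|edges S|]]).
  case/existsP=> S /and3P[pS qS eS]; have [|S' [S'S h1 h2 h3]] := IH S _ qS eS.
    by have := proper_card pS; lia.
  by exists S'; split=> //; apply: subset_trans S'S (proper_sub pS).
move/existsPn => mini; exists S0; split=> // C U cC nH x y xS xC xU yS yC.
apply: contraT => yU.
(* The two sides of the separation, each including [C]: proper subsets of [S0] that cover all its
   edges and overlap only in [C]. *)
pose T1 := [set z in S0 | (z \in U) || (z \in C)].
pose T2 := [set z in S0 | (z \notin U) || (z \in C)].
have T1S : T1 \subset S0 by apply/subsetP=> z; rewrite inE => /andP[].
have T2S : T2 \subset S0 by apply/subsetP=> z; rewrite inE => /andP[].
have p1 : T1 \proper S0.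
  by apply/properP; split=> //; exists y => //; rewrite inE yS (negbTE yU) (negbTE yC).
have p2 : T2 \proper S0.
  by apply/properP; split=> //; exists x => //; rewrite inE xS xU (negbTE xC).
have eT : #|edges S0| <= #|edges T1| + #|edges T2|.
  apply: leq_trans (leq_card_setU _ _).1; apply: subset_leq_card.
  apply/subsetP=> [[u v]]; rewrite !inE /= => /and3P[uS vS uv]; rewrite uS vS uv /= !andbT.
  case: (boolP (u \in C)) => uC; case: (boolP (v \in C)) => vC; rewrite ?orbT //=.
  - by case: (v \in U).
  - by case: (u \in U); rewrite ?orbT.
  case: (boolP (u \in U)) => uU; case: (boolP (v \in U)) => vU //=.
  - by have /andP[] := nH u v uS vS uC vC uU vU; rewrite uv.
  - by have /andP[] := nH v u vS uS vC uC vU uU; rewrite uv.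
have cT : #|T1| + #|T2| <= #|S0| + q.
  rewrite -cardsUI; apply: leq_add.
    by apply: subset_leq_card; rewrite subUset T1S.
  apply: leq_trans cC; apply: subset_leq_card; apply/subsetP=> z; rewrite !inE.
  by case: (z \in S0); case: (z \in U); case: (z \in C).
have c1 := proper_card p1; have c2 := proper_card p2.
have small S : S \proper S0 -> #|S| <= q -> #|edges S| <= q ^ 2.
  by move=> _ cS; apply: leq_trans (card_edges S) _; rewrite leq_sqr.
have large S : S \proper S0 -> q < #|S| -> #|edges S| < D * (#|S| - q).
  by move=> pS qS; have := mini S; rewrite pS qS /= -ltnNge.
have b1 := small _ p1; have b2 := small _ p2.
have l1 := large _ p1; have l2 := large _ p2.
move: eT cT c1 c2 b1 b2 l1 l2 Dq qS0 eS0.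
move: #|edges S0| #|edges T1| #|edges T2| #|T1| #|T2| #|S0| => e e1 e2 t1 t2 s0.
clear=> eT cT c1 c2 b1 b2 l1 l2 Dq qS0 eS0.
(* A side with at most [q] vertices has at most [q ^ 2] edges, negligible as [2 * q ^ 2 < D]; a
   larger side falls short of the edge bound by minimality. *)
case: (leqP t1 q) => h1; case: (leqP t2 q) => h2.
- have := b1 h1; have := b2 h2; have : D <= D * (s0 - q) by rewrite leq_pmulr // subn_gt0.
  lia.
- have := b1 h1; have := l2 h2; have : D * (t2 - q).+1 <= D * (s0 - q).
    by rewrite leq_mul2l; apply/orP; right; lia.
  rewrite mulnS; lia.
- have := b2 h2; have := l1 h1; have : D * (t1 - q).+1 <= D * (s0 - q).
    by rewrite leq_mul2l; apply/orP; right; lia.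
  rewrite mulnS; lia.
- have := l1 h1; have := l2 h2; have : D * ((t1 - q) + (t2 - q)) <= D * (s0 - q).
    by rewrite leq_mul2l; apply/orP; right; lia.
  rewrite mulnDr; lia.
Qed.

End Inseparable.

(** * Directed treewidth of a union of linked paths *)

Section ThreadedCell.
Variables (T I : finType) (E : rel T) (side : I -> bool).
Variables (L M : I -> {set T}) (al om : I -> T) (nu : I -> I).
Hypothesis threadL : forall n, thread E (L n) (al n) (om n).
Hypothesis threadM : forall n, thread E (M n) (om n) (al (nu n)).
Hypothesis disjL : forall n n' v, side n = side n' -> v \in L n -> v \in L n' -> n = n'.
Hypothesis disjM : forall n n' v, side n = side n' -> v \in M n -> v \in M n' -> n = n'.
Hypothesis nuI : injective nu.

(** A return path is included only when both paths of [L] that it joins have their index in [N]. *)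
Definition cell_graph (N : {set I}) : {set T} :=
  (\bigcup_(n in N) L n) :|: (\bigcup_(n in N | nu n \in N) M n).

(* If R is the set of live nodes reachable from a given node after deleting Z,
   then nu maps every live node of R or meeting R to a dead node, out of N or
   into R.  As nu is injective, few nodes outside R meet R: a directed
   separation yields an undirected one in the intersection graph. *)
Lemma cell_dtw (H : rel I) (N : {set I}) b :
  0 < b -> subrel H (fun n n' => L n :&: L n' != set0) ->
  #|exits nu N| <= 4 -> 12 * b < #|N| ->
  1600 * b ^ 2 * (#|N| - 12 * b) <= #|edges H N| ->
  dtw_ge (cell_graph N) E b.
Proof.
move=> b0 HL exN qN eN.
have [|S [SN qS eS insep]] := inseparable_subset _ qN eN.
  by rewrite expnMn; move: b0; clear; nia.
(* [1600 * b ^ 2] is the square of [40 * b], and [S] spans at most [#|S| ^ 2] edges. *)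
have cS : 40 * b <= #|S|.
  have := leq_trans eS (card_edges H S); have : 0 < #|S| - 12 * b by rewrite subn_gt0.
  move: #|S| (#|S| - 12 * b) => x y y0 h.
  have : (40 * b) ^ 2 <= x ^ 2.
    by apply: leq_trans h; rewrite expnMn leq_pmulr.
  by rewrite leq_sqr.
(* [8 * b + 4] bounds the separator [C] below: at most [4 * b] dead nodes and [4 * b + 4] others. It
   does not exceed the order [12 * b] of inseparability. *)
apply: (@dtw_ge_reach T I _ E b S al (8 * b + 4)) => Z cZ; set V := cell_graph N.
(* Paths are known to be disjoint only within one side of one family, so [Z] hits at most [b] paths
   in each of the four classes. *)
pose hitL d := [set n | (side n == d) && (L n :&: Z != set0)].
pose hitM d := [set n | (side n == d) && (M n :&: Z != set0)].
pose dead := (hitL true :|: hitL false) :|: (hitM true :|: hitM false).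
have cL d : #|hitL d| <= b.
  apply: leq_trans cZ; apply: (@card_meet _ _ _ _ L); first by move=> n; rewrite inE => /andP[].
  move=> n n' v; rewrite !inE => /andP[/eqP nd _] /andP[/eqP n'd _]; apply: disjL.
  by rewrite nd n'd.
have cM d : #|hitM d| <= b.
  apply: leq_trans cZ; apply: (@card_meet _ _ _ _ M); first by move=> n; rewrite inE => /andP[].
  move=> n n' v; rewrite !inE => /andP[/eqP nd _] /andP[/eqP n'd _]; apply: disjM.
  by rewrite nd n'd.
have cdead : #|dead| <= 4 * b.
  have u4 : #|dead| <= #|hitL true| + #|hitL false| + (#|hitM true| + #|hitM false|).
    apply: leq_trans (leq_card_setU _ _).1 _.
    by apply: leq_add; apply: (leq_card_setU _ _).1.
  move: u4 (cL true) (cL false) (cM true) (cM false).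
  move: #|dead| #|hitL true| #|hitL false| #|hitM true| #|hitM false|; clear; lia.
have liveL n : n \in N -> n \notin dead -> L n \subset V :\: Z.
  move=> nN nd; rewrite subsetD; apply/andP; split.
    by apply: subset_trans (subsetUl _ _); apply: bigcup_sup.
  rewrite -setI_eq0; apply: contraNT nd => hit; rewrite !inE hit.
  by case: (side n); rewrite ?orbT.
have liveM n : n \in N -> nu n \in N -> n \notin dead -> M n \subset V :\: Z.
  move=> nN nuN nd; rewrite subsetD; apply/andP; split.
    by apply: subset_trans (subsetUr _ _); apply: (bigcup_sup n); rewrite nN.
  rewrite -setI_eq0; apply: contraNT nd => hit; rewrite !inE hit.
  by case: (side n); rewrite ?orbT.
have aL n : al n \in L n by case: (threadL n).
pose G := S :\: dead.
have cG : #|S| <= #|G| + 4 * b.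
  have := cardsID dead S; have := subset_leq_card (subsetIr S dead).
  move: cdead; rewrite -/G; move: #|S| #|G| #|S :&: dead| #|dead|; clear; lia.
exists G; split.
- exact: subsetDl.
- by move: cG cS b0; move: #|S| #|G|; clear; lia.
- move=> n; rewrite inE => /andP[nd nS]; apply: (subsetP (liveL n _ nd)) => //.
  exact: (subsetP SN).
move=> i; rewrite inE => /andP[idead iS]; have iN := subsetP SN _ iS.
pose rch n := reach (V :\: Z) E (al i) (al n).
pose R := [set n in N | (n \notin dead) && rch n].
pose B := [set n in N | (n \notin dead) && ((n \in R) || [exists n' in R, L n' :&: L n != set0])].
have stepB n : n \in B -> [|| nu n \in R, nu n \in dead | n \in exits nu N].
  rewrite inE => /andP[nN /andP[nd hn]].
  case: (boolP (nu n \in N)) => nuN; last by rewrite [n \in exits _ _]inE nN nuN !orbT.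
  case: (boolP (nu n \in dead)) => nud; first by rewrite orbT.
  apply/orP; left; rewrite inE nuN nud /=.
  have [aQ oQ QL] := threadL n; have [oM aM QM] := threadM n.
  have toEnd v : v \in L n -> reach (V :\: Z) E v (al (nu n)).
    move=> vL; apply: (@reach_trans _ _ _ (om n)).
      exact: reach_subset (liveL n nN nd) (QL v vL).2.
    exact: reach_subset (liveM n nN nuN nd) (QM _ oM).2.
  case/orP: hn => [nR|/existsP[n' /andP[n'R /set0Pn[v /setIP[v1 v2]]]]].
    by move: nR; rewrite inE => /and3P[_ _ h]; apply: reach_trans h (toEnd _ aQ).
  move: n'R; rewrite inE => /and3P[n'N n'd h]; apply: reach_trans (toEnd v v2).
  apply: reach_trans h _; have [_ _ QL'] := threadL n'.
  exact: reach_subset (liveL n' n'N n'd) (QL' v v1).1.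
have RB : R \subset B.
  apply/subsetP=> n nR; move: (nR); rewrite [n \in R]inE => /and3P[nN nd _].
  by rewrite inE nN nd nR.
have cB : #|B| <= #|R| + 4 * b + 4.
  have : nu @: (B :\: exits nu N) \subset R :|: dead.
    apply/subsetP=> _ /imsetP[n + ->]; rewrite in_setD => /andP[ne /stepB].
    by rewrite (negbTE ne) orbF in_setU.
  move/subset_leq_card; rewrite card_imset // => h.
  have h1 := leq_trans h (leq_card_setU _ _).1.
  have h2 := cardsID (exits nu N) B; have h3 := subset_leq_card (subsetIr B (exits nu N)).
  move: h1 h2 h3 cdead exN; move: #|B :\: exits nu N| #|B :&: exits nu N| #|B| #|R| #|dead| #|exits nu N|.
  by clear; lia.
(* A live node of [N] outside [B] has a path disjoint from those of [R], so [C] separates [R] from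
   the rest of [N]. *)
pose C := (B :\: R) :|: dead.
have cC : #|C| <= 8 * b + 4.
  have h1 := (leq_card_setU (B :\: R) dead).1; have h2 := cardsID R B.
  rewrite (setIidPr RB) in h2; move: h1 h2 cB cdead; rewrite -/C.
  by move: #|C| #|B :\: R| #|B| #|R| #|dead|; clear; lia.
have iR : i \in R by rewrite inE iN idead /rch reach0.
apply: (leq_trans _ cC); apply: subset_leq_card; apply/subsetP=> j.
rewrite in_set in_setD => /andP[/andP[jd jS]]; apply: contraR => jC.
suff : j \in R by rewrite in_set => /and3P[].
apply: (insep C R _ _ i j) => //.
- by apply: (leq_trans cC); move: b0; clear; lia.
- move=> x y xS yS xC yC xR yR.
  have noL : L x :&: L y == set0.
    apply: contraR yC => xy; rewrite in_setU in_setD yR /=.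
    case: (boolP (y \in dead)) => yd; rewrite ?orbT // orbF inE (subsetP SN _ yS) yd /=.
    by apply/orP; right; apply/existsP; exists x; rewrite xR.
  apply/andP; split; apply/negP => /HL; rewrite ?noL // setIC noL //.
- by rewrite in_setU in_setD iR /=.
Qed.

End ThreadedCell.

Lemma card_sum_set (A B : finType) (N : {set A + B}) :
  #|N| = #|[set x | inl x \in N]| + #|[set y | inr y \in N]|.
Proof.
rewrite -!sum1_card big_mkcond /= big_sumType /=.
by congr (_ + _); rewrite [RHS]big_mkcond /=; apply: eq_bigr => x _; rewrite inE.
Qed.

Lemma conflictsE (T : finType) s (A B : 'I_s -> {set T}) :
  conflicts A B = #|[set xy : 'I_s * 'I_s | A xy.1 :&: B xy.2 != set0]|.
Proof.
rewrite /conflicts pair_bigA /= -sum1_card [RHS]big_mkcond /=.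
by apply: eq_bigr => xy _; rewrite inE; case: (_ != _).
Qed.

(** * Packing when two linkages intersect densely *)

Section Dense.
Variables (T : finType) (E : rel T) (a b s p w R0 : nat).
Hypotheses (a0 : 0 < a) (b0 : 0 < b) (R00 : 0 < R0).
Hypotheses (sE : s = p * w) (pE : p = 4 * a * R0) (wE : w = 4 * (1600 * b ^ 2) * R0).

(* A linkage L together with a return linkage M; nu x is the index of the path
   of L reached by following the x-th path of L and then M. *)
Record loom (L M : 'I_s -> {set T}) (al om : 'I_s -> T) (nu : 'I_s -> 'I_s) : Prop := Loom {
  loomL : forall x, thread E (L x) (al x) (om x);
  loomM : forall x, thread E (M x) (om x) (al (nu x));
  loom_disjL : forall x y v, v \in L x -> v \in L y -> x = y;
  loom_disjM : forall x y v, v \in M x -> v \in M y -> x = y;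
  loom_inj : injective nu }.

Variables (L M : 'I_s -> {set T}) (al om : 'I_s -> T) (nu : 'I_s -> 'I_s).
Variables (L' M' : 'I_s -> {set T}) (al' om' : 'I_s -> T) (nu' : 'I_s -> 'I_s).
Hypotheses (lm : loom L M al om nu) (lm' : loom L' M' al' om' nu').

Lemma dense_packing : s ^ 2 < R0 * conflicts L L' -> exists Vs : 'I_a -> {set T},
  (forall v, #|[set i | v \in Vs i]| <= 4) /\ forall i, dtw_ge (Vs i) E b.
Proof.
rewrite conflictsE => dense.
have cs : #|'I_s| = p * w by rewrite card_ord.
have [bX bXP] := perm_blocks (loom_inj lm) cs.
have [bY bYP] := perm_blocks (loom_inj lm') cs.
have [tX [tY [tXI tYI big]]] := @dense_cells s p w a (1600 * b ^ 2) R0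
  (fun x y => L x :&: L' y != set0) bX bY a0 sE pE wE
  (fun t => (bXP t).1) (fun t => (bYP t).1) dense.
pose pick (U : Type) (f g : 'I_s -> U) (n : 'I_s + 'I_s) : U :=
  match n with inl x => f x | inr y => g y end.
pose LL := pick _ L L'; pose MM := pick _ M M'.
pose aa := pick _ al al'; pose oo := pick _ om om'.
pose side (n : 'I_s + 'I_s) := if n is inl _ then true else false.
pose vv n := match n with inl x => inl (nu x) | inr y => inr (nu' y) end : 'I_s + 'I_s.
(* Oriented from the first linkage to the second, so that an intersecting pair is one edge, as in
   [cell]. *)
pose H (n n' : 'I_s + 'I_s) :=
  match n, n' with inl x, inr y => L x :&: L' y != set0 | _, _ => false end.
pose N i := [set n | pick _ (fun x => bX x == tX i) (fun y => bY y == tY i) n].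
exists (fun i => cell_graph LL MM vv (N i)); split=> [v|i].
  (* Distinct [i] use distinct blocks, so each of the four linkages contributes a vertex to at most
     one [i]. *)
  have one (t : 'I_a -> 'I_p) (bk : 'I_s -> 'I_p) (Q : 'I_s -> {set T}) : injective t ->
      (forall x y v, v \in Q x -> v \in Q y -> x = y) ->
      #|[set i | [exists x, (bk x == t i) && (v \in Q x)]]| <= 1.
    move=> tI Qd; apply: leq_cards1 => i j; rewrite !inE.
    move=> /existsP[x /andP[/eqP xi vx]] /existsP[y /andP[/eqP yj vy]].
    by apply: tI; rewrite -xi -yj (Qd x y v).
  pose S t (bk : 'I_s -> 'I_p) (Q : 'I_s -> {set T}) :=
    [set i : 'I_a | [exists x, (bk x == t i) && (v \in Q x)]].
  have sub : [set i | v \in cell_graph LL MM vv (N i)] \subset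
      (S tX bX L :|: S tY bY L') :|: (S tX bX M :|: S tY bY M').
    apply/subsetP=> i; rewrite inE => /setUP[] /bigcupP[[x|x]] /=; rewrite inE /= => h vx;
      rewrite !inE.
    - by apply/orP; left; apply/orP; left; apply/existsP; exists x; rewrite h.
    - by apply/orP; left; apply/orP; right; apply/existsP; exists x; rewrite h.
    - by apply/orP; right; apply/orP; left; apply/existsP; exists x; case/andP: h => ->.
    - by apply/orP; right; apply/orP; right; apply/existsP; exists x; case/andP: h => ->.
  apply: leq_trans (subset_leq_card sub) _; apply: leq_trans (leq_card_setU _ _).1 _.
  rewrite -[4]/(2 + 2); apply: leq_add; apply: leq_trans (leq_card_setU _ _).1 _;
    rewrite -[2]/(1 + 1); apply: leq_add; apply: one => //.
  - exact: (loom_disjL lm).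
  - exact: (loom_disjL lm').
  - exact: (loom_disjM lm).
  - exact: (loom_disjM lm').
have NX : [set x | inl x \in N i] = [set x | bX x == tX i] by apply/setP=> x; rewrite !inE.
have NY : [set y | inr y \in N i] = [set y | bY y == tY i] by apply/setP=> x; rewrite !inE.
have cN : #|N i| = 2 * w.
  by rewrite card_sum_set NX NY (bXP _).1 (bYP _).1 mul2n addnn.
apply: (@cell_dtw T ('I_s + 'I_s)%type E side LL MM aa oo vv _ _ _ _ _ H (N i) b b0).
- by case=> x; [apply: (loomL lm)|apply: (loomL lm')].
- by case=> x; [apply: (loomM lm)|apply: (loomM lm')].
- case=> x [] y v //= _; [move/(loom_disjL lm)|move/(loom_disjL lm')] => h /h -> //.
- case=> x [] y v //= _; [move/(loom_disjM lm)|move/(loom_disjM lm')] => h /h -> //.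
- by case=> x [] y //= [] => [/(loom_inj lm)|/(loom_inj lm')] ->.
- by case=> x [] y.
- rewrite card_sum_set -[4]/(2 + 2); apply: leq_add.
    apply: leq_trans (bXP (tX i)).2; apply: subset_leq_card; apply/subsetP=> x.
    by rewrite !inE.
  apply: leq_trans (bYP (tY i)).2; apply: subset_leq_card; apply/subsetP=> x.
  by rewrite !inE.
- by rewrite cN wE; move: b0 R00; clear; nia.
- rewrite cN; apply: leq_trans (_ : _ <= 2 * (1600 * b ^ 2) * w) _.
    apply: leq_trans (leq_mul (leqnn _) (leq_subr _ _)) _.
    by rewrite mulnCA !mulnA.
  apply: leq_trans (big i) _.
  have fI : injective (fun xy : 'I_s * 'I_s => (inl xy.1 : 'I_s + 'I_s, inr xy.2 : 'I_s + 'I_s)).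
    by case=> x y [x' y'] /= [-> ->].
  rewrite -(card_imset _ fI); apply: subset_leq_card.
  apply/subsetP=> _ /imsetP[[x y] + ->]; rewrite !inE /= => /and3P[h -> ->] //.
Qed.

End Dense.

(** * From a haven to the packing, and the constants *)

Lemma free_loom (T : finType) (E : rel T) k beta s (X Y : {set T}) :
  haven E (2 * k) beta -> s <= k -> free k beta E s X -> free k beta E s Y ->
  exists L M al om nu, [/\ @loom T E s L M al om nu,
    forall x, al x \in X & forall x, om x \in Y].
Proof.
move=> hE sk fX fY; have cX := fX.1; have cY := fY.1.
have [al alI alX] : exists2 al : 'I_s -> T, injective al & forall x, al x \in X.
  rewrite -cX; exists enum_val; [exact: enum_val_inj|exact: enum_valP].
have [L [om [tL dL omI omY]]] :=
  menger_threads cX cY (fun Z => @free_not_sep T k beta E s X Y Z hE sk fX fY) alI alX.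
have [M [om' [tM dM om'I om'X]]] :=
  menger_threads cY cX (fun Z => @free_not_sep T k beta E s Y X Z hE sk fY fX) omI omY.
(* Every vertex of [X] starts a path of [L], so each path of [M] ends at such a start. This defines
   [nu], which is injective because the ends are distinct. *)
have alE : [set al x | x in 'I_s] = X.
  apply/eqP; rewrite eqEcard cX card_imset // card_ord leqnn andbT.
  by apply/subsetP=> _ /imsetP[x _ ->].
have /fin_all_exists[nu nuE] x : exists y, om' x = al y.
  by have := om'X x; rewrite -{1}alE => /imsetP[y _ ->]; exists y.
exists L, M, al, om, nu; split=> //; split=> //; first by move=> x; rewrite -nuE.
by move=> x y e; apply: om'I; rewrite !nuE e.
Qed.

(** [R0] is [256] times the number of links, the threshold between the sparse and the dense case.
    [s] factors into [4 * a * R0] blocks of [4 * (1600 * b ^ 2) * R0] paths, and [k] is what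
    [2 * a * (16 * b)] nodes with two segments each consume. *)
Lemma packing_of_haven (T : finType) (E : rel T) a b R0 s k beta :
  0 < a -> 0 < b -> R0 = 256 * (2 * a * (16 * b * (16 * b))) ->
  s = 4 * a * R0 * (4 * (1600 * b ^ 2) * R0) ->
  k = 2 * a * (16 * b) * (s + s) -> haven E (2 * k) beta ->
  exists Vs : 'I_a -> {set T},
    (forall v, #|[set i | v \in Vs i]| <= 4) /\ forall i, dtw_ge (Vs i) E b.
Proof.
move=> a0 b0 R0E sE kE hE.
have R00 : 0 < R0 by rewrite R0E !muln_gt0 a0 b0.
have s0 : 0 < s by rewrite sE !muln_gt0 a0 R00 ?expn_gt0 ?b0.
have sk : s <= k.
  by rewrite kE mulnDr; apply: leq_trans (leq_addr _ _); rewrite leq_pmull // !muln_gt0 a0 b0.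
pose node := ('I_(2 * a) * 'I_(16 * b))%type.
have nk : #|{: node}| * (s + s) <= k by rewrite card_prod !card_ord kE.
have [P [A [B [pt [Pd ptP fr toP fromP]]]]] := haven_nodes hE s0 nk.
pose rk (x : node) := enum_rank x.
pose link := ('I_(2 * a) * ('I_(16 * b) * 'I_(16 * b)))%type.
pose data := (('I_s -> {set T}) * ('I_s -> {set T}) * ('I_s -> T) * ('I_s -> T) * ('I_s -> 'I_s))%type.
have /fin_all_exists[d dP] (l : link) : exists d : data,
    let: (L, M, al, om, nu) := d in [/\ loom E L M al om nu,
      forall x, al x \in B (rk (l.1, l.2.1)) & forall x, om x \in A (rk (l.1, l.2.2))].
  have [_ _ _ fB] := fr (rk (l.1, l.2.1)); have [_ _ fA _] := fr (rk (l.1, l.2.2)).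
  have [L [M [al [om [nu h]]]]] := free_loom hE sk fB fA.
  by exists (L, M, al, om, nu).
pose Q l := (d l).1.1.1.1.
have cl : #|{: link}| = 2 * a * (16 * b * (16 * b)) by rewrite !card_prod !card_ord.
case: (boolP [forall l, forall l', (l' != l) ==>
    (256 * #|{: link}| * conflicts (Q l) (Q l') <= s ^ 2)]).
  move=> /forallP sp.
  have [||g i j x|l l' ll'|Vs [cV dV]] := @sparse_packing T E a b s a0 b0 s0
     (fun x => P (rk x)) (fun x => pt (rk x)) Q.
  - by move=> i j v vi vj; apply: enum_rank_inj; apply: Pd vi vj.
  - by [].
  - have := dP (g, (i, j)); rewrite /Q; case: (d _) => [[[[L M] al] om] nu] /= [lm alB omA].
    have [alQ omQ QL] := loomL lm x.
    apply: (@reach_trans _ _ _ (al x)).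
      by apply: reach_subset (fromP _ _ (alB x)); rewrite -setUA; apply: subsetUl.
    apply: (@reach_trans _ _ _ (om x)).
      apply: reach_subset (QL _ omQ).1; rewrite setUAC; exact: subsetUr.
    by apply: reach_subset (toP _ _ (omA x)); apply: subsetUr.
  - by have /forallP/(_ l') := sp l; rewrite ll'.
  by exists Vs; split=> // v; apply: leq_trans (cV v) _.
case/forallPn=> l /forallPn[l']; rewrite negb_imply -ltnNge cl -R0E => /andP[_ dense].
have := dP l; have := dP l'; move: dense; rewrite /Q.
case: (d l) => [[[[L M] al] om] nu]; case: (d l') => [[[[L' M'] al'] om'] nu'] /=.
move=> dense [lm' _ _] [lm _ _].
exact: (@dense_packing T E a b s _ _ R0 a0 b0 R00 sE erefl erefl _ _ _ _ _ _ _ _ _ _ lm lm' dense).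
Qed.

Lemma dtw_ge_leq (T : finType) (V : {set T}) E k k' :
  k' <= k -> dtw_ge V E k -> dtw_ge V E k'.
Proof.
move=> kk [V0 h]; split=> // n root par W X /h[t kt]; exists t; exact: leq_ltn_trans kt.
Qed.

(** [R0] is of order [a * b ^ 2], so [s] is of order [a ^ 3 * b ^ 6] and the treewidth consumed of
    order [a ^ 4 * b ^ 7]. The constant collects the numerical factors; its final [1] absorbs that
    of [3 * K + 1]. *)
Definition dtw_const : nat := 6 * (2 * 16 * 2) * (4 * 4 * 1600) * (256 * (2 * (16 * 16))) ^ 2 + 1.

Lemma dtw_const_bound a b R0 s : 0 < a -> 0 < b ->
  R0 = 256 * (2 * a * (16 * b * (16 * b))) ->
  s = 4 * a * R0 * (4 * (1600 * b ^ 2) * R0) ->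
  3 * (2 * (2 * a * (16 * b) * (s + s))) + 1 <= dtw_const * (a ^ 6 * b ^ 8).
Proof.
move=> a0 b0 R0E sE; rewrite /dtw_const.
set c2 := (256 * (2 * (16 * 16))); set c1 := (4 * 4 * 1600).
have {}R0E : R0 = c2 * (a * b ^ 2) by rewrite R0E /c2; lia.
have {}sE : s = c1 * c2 ^ 2 * (a ^ 3 * b ^ 6) by rewrite sE R0E /c1; lia.
have -> : 3 * (2 * (2 * a * (16 * b) * (s + s))) =
    6 * (2 * 16 * 2) * c1 * c2 ^ 2 * (a ^ 4 * b ^ 7) by rewrite sE; lia.
have le : a ^ 4 * b ^ 7 <= a ^ 6 * b ^ 8.
  by apply: leq_mul; apply: leq_pexp2l.
rewrite [X in _ <= X]mulnDl mul1n; apply: leq_add; last by rewrite muln_gt0 !expn_gt0 a0 b0.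
by rewrite leq_mul2l le orbT.
Qed.

(** The maximum in [dtw_bound] makes the logarithmic factor at least [1]. *)
Lemma dtw_bound_le a b N :
  Rle (dtw_bound (INR dtw_const) a b) (INR N) -> dtw_const * (a ^ 6 * b ^ 8) <= N.
Proof.
rewrite /dtw_bound => le; apply/leP/INR_le; apply: Rle_trans le.
have INRM x y : INR (x * y) = Rmult (INR x) (INR y) by apply: mult_INR.
have INRX x n : INR (x ^ n) = pow (INR x) n.
  by elim: n => [|n IH] //; rewrite expnS INRM IH.
rewrite INRM INRM !INRX -Rmult_assoc.
set u := Rmult _ _; rewrite -{1}[u]Rmult_1_r.
apply: Rmult_le_compat_l.
  rewrite /u; apply: Rmult_le_pos; [apply: Rmult_le_pos; [exact: pos_INR|]|];
    apply: pow_le; exact: pos_INR.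
have := Rmax_l (IZR 1) (ln (INR (a * b))); set m := Rmax _ _ => m1.
rewrite /= Rmult_1_r -[X in Rle X _]Rmult_1_r.
by apply: Rmult_le_compat => //; apply: Rle_0_1.
Qed.

Theorem theorem5 :
  exists c : R,
  forall (T : finType) (E : rel T) (a b : nat),
    0 < a -> 0 < b ->
    dtw_geR [set: T] E (dtw_bound c a b) ->
    exists (Vs : 'I_a -> {set T}) (Es : 'I_a -> rel T),
      (* (1) each G_i = (Vs i, Es i) is a subgraph of G *)
      (forall i, Vs i \subset [set: T]) /\
      (forall i u v, Es i u v -> E u v) /\
      (* (2) each vertex lies in at most four of the G_i *)
      (forall v : T, #|[set i | v \in Vs i]| <= 4) /\
      (* (3) each G_i has directed treewidth at least b *)
      (forall i, dtw_ge (Vs i) (Es i) b).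
Proof.
exists (INR dtw_const) => T E a b a0 b0 [N [/dtw_bound_le cN dN]].
pose R0 := 256 * (2 * a * (16 * b * (16 * b))).
pose s := 4 * a * R0 * (4 * (1600 * b ^ 2) * R0).
have dK := dtw_ge_leq (leq_trans (@dtw_const_bound a b R0 s a0 b0 erefl erefl) cN) dN.
have [beta hE] := dtw_ge_haven dK.
have [Vs [cV dV]] := packing_of_haven a0 b0 erefl erefl erefl hE.
(* The packed graphs are the subgraphs induced on the sets [Vs i]. *)
exists Vs, (fun=> E); split=> [i|]; first exact: subsetT.
by split=> //; split.
Qed.
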